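(* (a) Let $\{P_i : i\in I\}$ be a finite family of symmetric convex sets in $\mathbb{R}^n$ with $\operatorname{diam}\left(\bigcap_{i\in I}P_i\right)=1$. For every real $d>1$ there exist a natural number $s\leq dn$ and indices $i_1,\ldots,i_s\in I$ such that $$\operatorname{diam}(P_{i_1}\cap\cdots\cap P_{i_s})\leq \gamma_d\sqrt{n},$$ where $\gamma_d:=\frac{\sqrt{d}+1}{\sqrt{d}-1}$. (b) There exist absolute constants $\alpha>1$ and $c>0$ (independent of the dimension $n$ and of the family) with the following property: if $\{P_i : i\in I\}$ is a finite family of convex bodies in $\mathbb{R}^n$ with $\operatorname{diam}\left(\bigcap_{i\in I}P_i\right)=1$, then there exist a natural number $s\leq\alpha n$ and indices $i_1,\ldots,i_s\in I$ such that $$\operatorname{diam}(P_{i_1}\cap\cdots\cap P_{i_s})\leq c\,n^{3/2}.$$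
   Context: A convex set $K\subseteq\mathbb{R}^n$ is symmetric if $x\in K$ implies $-x\in K$. A convex body in $\mathbb{R}^n$ is a compact convex subset of $\mathbb{R}^n$ with non-empty interior. $\operatorname{diam}$ denotes the diameter with respect to the Euclidean norm (it is $+\infty$ for unbounded sets). *)

(* Defs.v *)
From HB Require Import structures.
From mathcomp Require Import all_boot all_order all_algebra.
From mathcomp Require Import all_classical all_reals all_analysis.

Set Implicit Arguments.
Unset Strict Implicit.
Unset Printing Implicit Defensive.

Import Order.TTheory GRing.Theory Num.Theory.
Import numFieldNormedType.Exports.

Local Open Scope classical_set_scope.
Local Open Scope ring_scope.

(* The library's norm `|x| on 'rV[R]_n is the sup norm, hence a separate
   Euclidean norm. Both norms induce the library's topology on 'rV[R]_n. *)
Definition enorm (R : realType) (n : nat) (x : 'rV[R]_n) : R :=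
  Num.sqrt (\sum_(k < n) x ord0 k ^+ 2).

(* With this definition diam set0 = -oo. *)
Definition diam (R : realType) (n : nat) (A : set 'rV[R]_n) : \bar R :=
  ereal_sup [set (enorm (p.1 - p.2))%:E | p in A `*` A].

Definition symmetric_set (R : realType) (n : nat) (A : set 'rV[R]_n) : Prop :=
  forall x, A x -> A (- x).

Definition convex_body (R : realType) (n : nat) (A : set 'rV[R]_n) : Prop :=
  [/\ compact A, convex_set A & A° !=set0].

Definition gamma (R : realType) (d : R) : R :=
  (Num.sqrt d + 1) / (Num.sqrt d - 1).

(* Main.v *)
Require Import Defs.
From HB Require Import structures.
From mathcomp Require Import all_boot all_order all_algebra ring lra.
From mathcomp Require Import finmap.
From mathcomp Require Import all_classical all_reals all_analysis.

(* Suppose every s-element subfamily has an intersection that is too large, and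
   pick witness points in each of these finitely many intersections. Replacing
   P_i by the convex hull of 0 and the witnesses it contains, one may assume
   that the P_i are polytopes; separation and compactness of a sphere then
   produce finitely many vectors u_j, each attached to one P_i, such that
   <x, u_j> <= 1 on P_i and the halfspaces <x, u_j> <= 1 cut out a set of
   controlled radius r.

   (a) Among all families of s of the u_j (with repetitions), take one
   maximizing det A, A = sum u u^T. Exchanging one of its members for an
   arbitrary u_j cannot increase det A; averaging over the exchanged member
   gives <A^-1 u_j, u_j> <= n / (s - n + 1) for every j. If |<x, u>| <= 1 on the
   family then <A x, x> <= s, so <x, u_j>^2 <= s n / (s - n + 1) for all j, and
   |x|^2 <= r^2 s n / (s - n + 1). For s = floor (d n) this beats gamma_d^2 n r^2.

   (b) Put the ellipsoid of maximal volume inscribed in the halfspaces in the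
   position of the unit ball: there are vectors |v_j| <= 1 and weights c_j with
   sum c_j v_j v_j^T = I and sum c_j v_j = 0. The one-sided barrier argument of
   Batson, Spielman and Srivastava selects 4n of the v_j with weights b_j of
   total O(n^2) and sum b_j v_j v_j^T >= 2n I; at every step the choice can also
   be made so that m = sum b_j v_j has norm O(n^(3/2)). By Caratheodory, n more
   of the v_j bound <x, -m> by n |m|. If <x, v_j> <= 1 on all these, then
   2n |x|^2 <= |x| sum b_j |<x, v_j>| <= |x| (2 sum b_j - <x, m>) = |x| O(n^(5/2)). *)

Set Implicit Arguments.
Unset Strict Implicit.
Unset Printing Implicit Defensive.

Import Order.TTheory GRing.Theory Num.Theory.
Import numFieldNormedType.Exports.

Local Open Scope classical_set_scope.
Local Open Scope ring_scope.

(** * Quadratic forms *)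

Section Dot.
Variables (R : realFieldType) (n : nat).
Implicit Types (x y v w : 'rV[R]_n) (A B : 'M[R]_n).

Definition dot x y : R := \sum_k x ord0 k * y ord0 k.

Lemma dotE x y : dot x y = (x *m y^T) 0 0.
Proof. by rewrite mxE; apply: eq_bigr => k _; rewrite mxE. Qed.

Lemma dotC x y : dot x y = dot y x.
Proof. by apply: eq_bigr => k _; rewrite mulrC. Qed.

Lemma dotDl x y v : dot (x + y) v = dot x v + dot y v.
Proof. by rewrite !dotE mulmxDl mxE. Qed.

Lemma dotZl a x y : dot (a *: x) y = a * dot x y.
Proof. by rewrite !dotE -scalemxAl mxE. Qed.

Lemma dotNl x y : dot (- x) y = - dot x y.
Proof. by rewrite -scaleN1r dotZl mulN1r. Qed.

Lemma dotDr x y v : dot v (x + y) = dot v x + dot v y.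
Proof. by rewrite dotC dotDl !(dotC v). Qed.

Lemma dotZr a x y : dot x (a *: y) = a * dot x y.
Proof. by rewrite dotC dotZl dotC. Qed.

Lemma dotNr x y : dot x (- y) = - dot x y.
Proof. by rewrite dotC dotNl dotC. Qed.

Lemma dot0l y : dot 0 y = 0.
Proof. by rewrite -[0](scale0r y) dotZl mul0r. Qed.

Lemma dot0r y : dot y 0 = 0.
Proof. by rewrite dotC dot0l. Qed.

Lemma dot_suml (J : finType) (P : pred J) (F : J -> 'rV[R]_n) y :
  dot (\sum_(j | P j) F j) y = \sum_(j | P j) dot (F j) y.
Proof. by elim/big_rec2: _ => [|j a b _ <-]; rewrite ?dot0l ?dotDl. Qed.

Lemma dot_sumr (J : finType) (P : pred J) (F : J -> 'rV[R]_n) y :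
  dot y (\sum_(j | P j) F j) = \sum_(j | P j) dot y (F j).
Proof. by rewrite dotC dot_suml; apply: eq_bigr => j _; rewrite dotC. Qed.

Lemma dot_mull x A y : dot (x *m A) y = dot x (y *m A^T).
Proof. by rewrite !dotE trmx_mul trmxK mulmxA. Qed.

Lemma dot_ge0 x : 0 <= dot x x.
Proof. by apply: sumr_ge0 => k _; rewrite -expr2 sqr_ge0. Qed.

Lemma dot_eq0 x : (dot x x == 0) = (x == 0).
Proof.
apply/idP/eqP => [|->]; last by rewrite dot0l.
move/eqP/psumr_eq0P => h; apply/rowP => k; rewrite mxE; apply/eqP.
by rewrite -sqrf_eq0 expr2 h// => i _; rewrite -expr2 sqr_ge0.
Qed.

Lemma dot_gt0 x : x != 0 -> 0 < dot x x.
Proof. by move=> x0; rewrite lt0r dot_eq0 x0 dot_ge0. Qed.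

Lemma dot_delta x k : dot x (delta_mx 0 k) = x 0 k.
Proof.
rewrite /dot (bigD1 k) //= big1 ?addr0 => [|i /negPf ik].
  by rewrite mxE !eqxx mulr1.
by rewrite mxE ik andbF mulr0.
Qed.

Lemma mulmx_outer x v w : x *m (v^T *m w) = dot x v *: w.
Proof. by rewrite mulmxA (mx11_scalar (x *m v^T)) mul_scalar_mx dotE. Qed.

Lemma tr_outer A v w : \tr (A *m (v^T *m w)) = dot (w *m A) v.
Proof.
by rewrite mulmxA mxtrace_mulC mulmxA /mxtrace big_ord1 dotE.
Qed.

Lemma tr_sumE A : \tr A = \sum_k dot (delta_mx 0 k *m A) (delta_mx 0 k).
Proof. by apply: eq_bigr => k _; rewrite dot_delta -rowE mxE. Qed.

Lemma sqr_dot_le x y : dot x y ^+ 2 <= dot x x * dot y y.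
Proof.
have [->|y0] := eqVneq y 0; first by rewrite !dot0r expr0n mulr0.
have := dot_ge0 (dot y y *: x - dot x y *: y).
rewrite !(dotDl, dotDr, dotNl, dotNr, dotZl, dotZr) (dotC y x).
have := dot_gt0 y0; set a := dot y y; set b := dot x y; set c := dot x x => a0.
rewrite (_ : _ + _ = a * (c * a - b ^+ 2)); last by ring.
by rewrite pmulr_rge0// subr_ge0.
Qed.

Definition posdef A := A^T = A /\ forall x, x != 0 -> 0 < dot (x *m A) x.

Lemma posdef_unit A : posdef A -> A \in unitmx.
Proof.
move=> [_ pA]; rewrite -row_free_unit -kermx_eq0; apply/negP => /negP k0.
case/rowV0Pn: k0 => v; rewrite (sameP sub_kermxP eqP) => /eqP vA v0.
by have := pA _ v0; rewrite vA dot0l ltxx.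
Qed.

Lemma posdef_ge0 A x : posdef A -> 0 <= dot (x *m A) x.
Proof.
move=> [_ pA]; have [->|/pA/ltW//] := eqVneq x 0.
by rewrite mul0mx dot0l.
Qed.

Lemma posdef_inv A : posdef A -> posdef (invmx A).
Proof.
move=> pA; have uA := posdef_unit pA; have [sA qA] := pA.
split=> [|x x0]; first by rewrite trmx_inv sA.
have y0 : x *m invmx A != 0.
  by apply: contraNneq x0 => h; rewrite -(mulmxKV uA x) h mul0mx.
by have := qA _ y0; rewrite mulmxKV// dotC.
Qed.

Lemma posdef_add A B : posdef A -> B^T = B ->
  (forall x, 0 <= dot (x *m B) x) -> posdef (A + B).
Proof.
move=> [sA pA] sB pB; split=> [|x x0]; first by rewrite linearD/= sA sB.
by rewrite mulmxDr dotDl ltr_pwDl ?pA.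
Qed.

(** Cauchy-Schwarz between the dual forms of [A] and its inverse: the form of [A] is nonnegative at
    [a x - <x, y> y A^-1], where [a = <y A^-1, y>]. *)
Lemma posdef_cauchy A x y : posdef A ->
  dot x y ^+ 2 <= dot (x *m A) x * dot (y *m invmx A) y.
Proof.
move=> pA; have uA := posdef_unit pA; have pY := posdef_inv pA.
have [->|y0] := eqVneq y 0; first by rewrite mul0mx !dot0r expr0n mulr0.
have := pY.2 _ y0; set a := dot (y *m _) y => a0.
have := posdef_ge0 (a *: x - dot x y *: (y *m invmx A)) pA.
rewrite mulmxBl -!scalemxAl mulmxKV//.
rewrite !(dotDl, dotDr, dotNl, dotNr, dotZl, dotZr).
have -> : dot (x *m A) (y *m invmx A) = dot x y.
  by rewrite dot_mull pA.1 mulmxKV.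
rewrite [dot y (_ *m _)]dotC -/a (dotC y x); set b := dot x y; set c := dot _ x.
rewrite (_ : _ + _ = a * (c * a - b ^+ 2)); last by ring.
by rewrite pmulr_rge0// subr_ge0.
Qed.

Lemma dot_sum_sqr x : dot x x = \sum_k dot x (delta_mx 0 k) ^+ 2.
Proof. by apply: eq_bigr => k _; rewrite dot_delta expr2. Qed.

(** Stands in for the bound [1 / \tr A^-1] on the least eigenvalue: [posdef_cauchy] against each
    basis vector, then summed. *)
Lemma posdef_trace_lb A x : posdef A ->
  dot x x <= dot (x *m A) x * \tr (invmx A).
Proof.
move=> pA; rewrite dot_sum_sqr tr_sumE mulr_sumr; apply: ler_sum => k _.
exact: posdef_cauchy.
Qed.

Lemma posdef_sandwich_trace A B : posdef A -> B^T = B -> 0 <= \tr (B *m A *m B).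
Proof.
move=> pA sB; rewrite tr_sumE; apply: sumr_ge0 => k _.
by rewrite !mulmxA dot_mull sB posdef_ge0.
Qed.

(** The Sherman-Morrison formula; it rests on [V X V = q V] for the rank-one matrix [V]. *)
Lemma inv_rank1 A v t : A \in unitmx -> 1 + t * dot (v *m invmx A) v != 0 ->
  invmx (A + t *: (v^T *m v)) =
  invmx A - (t / (1 + t * dot (v *m invmx A) v)) *:
     (invmx A *m (v^T *m v) *m invmx A).
Proof.
set X := invmx A; set V := v^T *m v; set q := dot _ v => uA q0.
set k := t / _; set B := X - _.
have VXV : V *m (X *m V) = q *: V.
  by rewrite mulmxA -(mulmxA v^T v X) -(mulmxA v^T) mulmx_outer -scalemxAr.
clearbody V; have h : (A + t *: V) *m B = 1%:M.
  rewrite /B mulmxDl !mulmxBr mulmxV// -!scalemxAr -!scalemxAl !mulmxA mulmxV//.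
  rewrite mul1mx -[V *m X *m V]mulmxA VXV -scalemxAl !scalerA -addrA -scaleNr.
  rewrite -scalerBl -scalerDl (_ : - k + (t - k * t * q) = 0) ?scale0r ?addr0//.
  by rewrite /k; field.
have [u _] := mulmx1_unit h.
by rewrite -[LHS]mulmx1 -h mulmxA mulVmx// mul1mx.
Qed.

(** Both sides are the determinant of the matrix with block rows [(1, -w)] and [(v^T, A)], factored
    by eliminating either the lower left or the upper right block. *)
Lemma det_rank1 A v w : A \in unitmx ->
  \det (A + v^T *m w) = \det A * (1 + dot (w *m invmx A) v).
Proof.
move=> uA.
have h : block_mx 1%:M (- w) v^T A = block_mx 1%:M 0 v^T 1%:M *m
   block_mx 1%:M (- w) 0 (A + v^T *m w) :> 'M[R]_(1 + n).
  rewrite mulmx_block !mul1mx !mulmx1 !mul0mx !addr0 mulmxN.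
  by rewrite addrC addrK.
have h' : block_mx 1%:M (- w) v^T A = block_mx 1%:M (- w *m invmx A) 0 1%:M *m
   block_mx (1%:M + w *m invmx A *m v^T) 0 v^T A :> 'M[R]_(1 + n).
  rewrite mulmx_block !mul1mx !mul0mx !mulNmx mulmxKV// !add0r addrK.
  by rewrite ?mulmx0 ?add0r.
have := congr1 determinant h; rewrite h' !det_mulmx !det_lblock !det_ublock.
by rewrite !det1 !mul1r => <-; rewrite det_mx11 mxE dotE mxE eqxx mulrC.
Qed.

End Dot.

(** * Determinant-maximizing subfamilies *)

Section DOptimal.
Variables (R : realFieldType) (n : nat).
Implicit Types (x y v w : 'rV[R]_n) (A B : 'M[R]_n).

Lemma posdef_outer_add A v : posdef A -> posdef (A + v^T *m v).
Proof.
move=> pA; apply: posdef_add => // [|x]; first by rewrite trmx_mul trmxK.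
by rewrite mulmx_outer dotZl (dotC v) -expr2 sqr_ge0.
Qed.

(** Adding [w] before removing [v] keeps the intermediate matrix positive definite, so [det_rank1]
    applies twice; [inv_rank1] expresses the intermediate inverse through that of [A]. *)
Lemma det_swap A v w : posdef A ->
  \det (A + w^T *m w - v^T *m v) = \det A *
    ((1 - dot (v *m invmx A) v) * (1 + dot (w *m invmx A) w)
     + dot (v *m invmx A) w ^+ 2).
Proof.
move=> pA; have uA := posdef_unit pA.
have l0 : 0 <= dot (w *m invmx A) w := posdef_ge0 _ (posdef_inv pA).
have l1 : 1 + dot (w *m invmx A) w != 0 by rewrite gt_eqF// ltr_pwDl.
have uB := posdef_unit (posdef_outer_add w pA).
rewrite -mulmxN det_rank1// det_rank1// -mulrA; congr (_ * _).
have := @inv_rank1 _ _ A w 1 uA; rewrite !scale1r mul1r => -> //.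
have XT : (invmx A)^T = invmx A by case: (posdef_inv pA).
rewrite mulNmx dotNl mulmxBr -scalemxAr mulmxA (mulmxA v) mulmx_outer.
rewrite -scalemxAl dotDl dotNl !dotZl.
rewrite [dot (w *m _) v]dot_mull XT [dot w _]dotC.
by field.
Qed.

(** The frame operator of a family with possible repetitions; families form a finite type, so a
    maximizer of the determinant exists. *)
Definition gram (J : finType) (u : J -> 'rV[R]_n) s (f : {ffun 'I_s -> J}) :=
  \sum_k (u (f k))^T *m u (f k).

Lemma gram_tr J u s f : (@gram J u s f)^T = gram u f.
Proof.
rewrite /gram raddf_sum; apply: eq_bigr => k _.
by rewrite /= trmx_mul trmxK.
Qed.

Lemma dot_gram J u s f x : dot (x *m @gram J u s f) x = \sum_k dot x (u (f k)) ^+ 2.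
Proof.
rewrite /gram mulmx_sumr dot_suml; apply: eq_bigr => k _.
by rewrite mulmx_outer dotZl (dotC _ x) expr2.
Qed.

Lemma gram_posdef (J : finType) (u : J -> 'rV[R]_n) (s : nat) (j0 : J) :
  (n <= s)%N -> (forall x, (forall j, dot x (u j) = 0) -> x = 0) ->
  exists f : {ffun 'I_s -> J}, posdef (gram u f).
Proof.
move=> ns span.
pose W := \matrix_(j < #|J|) u (enum_val j).
have fW : row_full W.
  rewrite /row_full -mxrank_tr -/(row_free _) -kermx_eq0; apply/negP => /negP k0.
  case/rowV0Pn: k0 => v; rewrite (sameP sub_kermxP eqP) => /eqP vA.
  apply/negP; rewrite negbK; apply/eqP/span => j.
  have /rowP/(_ (enum_rank j)) := vA; rewrite !mxE => <-.
  by apply: eq_bigr => k _; rewrite !mxE enum_rankK.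
(* The first [n] slots hold a basis chosen among the [u j]; the remaining ones default to [j0]. *)
pose g (k : nat) := if insub k is Some i then enum_val (fullrankfun fW i) else j0.
exists [ffun k : 'I_s => g k]; split=> [|x x0]; first exact: gram_tr.
rewrite lt_neqAle dot_gram eq_sym; apply/andP; split; last first.
  by apply: sumr_ge0 => k _; rewrite sqr_ge0.
apply: contraNneq x0 => /psumr_eq0P h.
have uf : rowsub (fullrankfun fW) W \in unitmx.
  by rewrite -row_full_unit; exact: fullrowsub_full.
suff x0 : rowsub (fullrankfun fW) W *m x^T = 0.
  by rewrite -[x]trmxK -(mulKmx uf x^T) x0 mulmx0 trmx0.
apply/colP => i; rewrite !mxE; under eq_bigr do rewrite !mxE.
have := h _ (widen_ord ns i) isT; rewrite ffunE /g /=.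
case: insubP => [i' _ /val_inj ->|]; last by rewrite /= ltn_ord.
move=> hh; apply/eqP; rewrite -sqrf_eq0; apply/eqP; rewrite -[RHS]hh => [|k _].
  by congr (_ ^+ 2); apply: eq_bigr => k _; rewrite mulrC.
by rewrite sqr_ge0.
Qed.

(* Exchanging any member of a determinant-maximizing family for [u j] cannot
   increase the determinant; averaging over the exchanged member bounds the
   leverage of [u j]. *)
Lemma leverage_le (J : finType) (u : J -> 'rV[R]_n) s (f : {ffun 'I_s -> J}) j :
  posdef (gram u f) ->
  (forall g : {ffun 'I_s -> J}, `|\det (gram u g)| <= `|\det (gram u f)|) ->
  (s%:R - n%:R + 1) * dot (u j *m invmx (gram u f)) (u j) <= n%:R.
Proof.
move=> pA fmax; set X := invmx _; set l := fun v => dot (v *m X) v.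
have uA := posdef_unit pA.
have step i : (1 - l (u (f i))) * (1 + l (u j)) + dot (u (f i) *m X) (u j) ^+ 2 <= 1.
  pose g := [ffun k => if k == i then j else f k].
  have gE : gram u g = gram u f + (u j)^T *m u j - (u (f i))^T *m u (f i).
    rewrite /gram (bigD1 i)//= [in RHS](bigD1 i)//= ffunE eqxx.
    rewrite [RHS]addrAC [X in X - _]addrC addrK [RHS]addrC; congr (_ + _).
    by apply: eq_bigr => k /negPf ki; rewrite ffunE ki.
  have := fmax g; rewrite gE det_swap// normrM -/X ger_pMr ?normr_gt0.
    by move/(le_trans (ler_norm _)).
  by rewrite -unitfE -unitmxE.
(* The leverages of the members sum to the trace of [A^-1 A]. *)
have suml : \sum_i l (u (f i)) = n%:R.
  rewrite -[RHS](@mxtrace1 R n) -(mulVmx uA) -/X /gram mulmx_sumr raddf_sum.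
  by apply: eq_bigr => i _ /=; rewrite tr_outer.
have sumq : \sum_i dot (u (f i) *m X) (u j) ^+ 2 = l (u j).
  have XT : X^T = X by case: (posdef_inv pA).
  transitivity (dot (u j *m X *m gram u f) (u j *m X)).
    by rewrite dot_gram; apply: eq_bigr => i _; rewrite dot_mull XT dotC.
  by rewrite mulmxKV// dotC.
(* Summed over [i], the exchange inequalities read [(s - n) (1 + l) + l <= s], with [l] the leverage
   of [u j]. *)
have : \sum_(i < s) ((1 - l (u (f i))) * (1 + l (u j)) + dot (u (f i) *m X) (u j) ^+ 2)
   <= \sum_(i < s) 1 by apply: ler_sum.
rewrite big_split/= sumq -mulr_suml sumrB suml sumr_const card_ord -/(l (u j)).
by move: (l (u j)) => z h; lra.
Qed.

End DOptimal.

Lemma dopt_subfamily (R : rcfType) n (J : finType) (u : J -> 'rV[R]_n) (s : nat) (r2 : R) :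
  (0 < n <= s)%N ->
  (forall x, (forall j, dot x (u j) <= 1) -> dot x x < r2) ->
  exists f : 'I_s -> J, forall x, (forall k, `|dot x (u (f k))| <= 1) ->
    dot x x <= r2 * (n%:R * s%:R / (s%:R - n%:R + 1)).
Proof.
move=> /andP[n0 ns] bnd.
have r20 : 0 < r2.
  by have := bnd 0; rewrite dot0l; apply=> j; rewrite dot0l ler01.
have span x : (forall j, dot x (u j) = 0) -> x = 0.
  move=> h; apply/eqP; rewrite -dot_eq0; apply/negPn/negP => x0.
  have a0 : 0 < dot x x by rewrite lt0r x0 dot_ge0.
  (* A nonzero vector orthogonal to all [u j] can be stretched inside the halfspaces; this factor
     already pushes its squared norm past [r2]. *)
  pose c := 1 + r2 / dot x x.
  have /bnd : forall j, dot (c *: x) (u j) <= 1 by move=> j; rewrite dotZl h mulr0 ler01.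
  have c1 : 1 <= c by rewrite lerDl divr_ge0 ?ltW.
  have ca : dot x x + r2 = c * dot x x by rewrite mulrDl mul1r divfK ?gt_eqF.
  have : dot x x + r2 <= c * (c * dot x x).
    by rewrite -ca ler_peMl// addr_ge0// ltW.
  by rewrite dotZl dotZr => h1 h2; lra.
have [j0 _|J0] := pickP J; last first.
  have x0 (x : 'rV[R]_n) : x = 0 by apply: span => j; have := J0 j.
  have /rowP/(_ (Ordinal n0)) := x0 (const_mx 1).
  by rewrite !mxE => /eqP; rewrite oner_eq0.
have [f0 pf0] := gram_posdef j0 ns span.
have [f _ fmax] := @arg_maxP _ _ _ f0 predT (fun f => `|\det (gram u f)|) isT.
have uf : gram u f \in unitmx.
  have := fmax f0 isT; rewrite unitmxE unitfE -!normr_gt0; apply: lt_le_trans.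
  by rewrite normr_gt0 -unitfE -unitmxE posdef_unit.
have pf : posdef (gram u f).
  split=> [|x x0]; first exact: gram_tr.
  rewrite lt_neqAle dot_gram eq_sym; apply/andP; split; last first.
    by apply: sumr_ge0 => k _; rewrite sqr_ge0.
  apply: contraNneq x0 => /psumr_eq0P h.
  rewrite -(mulmxK uf x) /gram mulmx_sumr big1 ?mul0mx// => k _.
  rewrite mulmx_outer; have /eqP := h (fun i _ => sqr_ge0 _) k isT.
  by rewrite sqrf_eq0 => /eqP ->; rewrite scale0r.
exists f => x xf; set M := _ / _.
have d0 : 0 < s%:R - n%:R + 1 :> R by rewrite ltr_wpDl// subr_ge0 ler_nat.
have M0 : 0 < M.
  by rewrite divr_gt0// mulr_gt0// ltr0n//; exact: leq_trans ns.
have xA : dot (x *m gram u f) x <= s%:R.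
  rewrite dot_gram -[s in s%:R]card_ord -sumr_const; apply: ler_sum => k _.
  by rewrite -[leRHS](expr1n _ 2) -real_normK ?num_real// lerXn2r ?nnegrE ?ler01.
have xj j : dot x (u j) ^+ 2 <= M.
  have := posdef_cauchy x (u j) pf; move/le_trans; apply.
  have l0 := posdef_ge0 (u j) (posdef_inv pf).
  have := leverage_le j pf (fun g => fmax g isT).
  rewrite -ler_pdivlMl// => lj.
  apply: le_trans (ler_pM (posdef_ge0 _ pf) l0 xA lj) _.
  by rewrite /M mulrCA mulrC [n%:R * s%:R]mulrC.
have t0 : 0 < Num.sqrt M by rewrite sqrtr_gt0.
(* Shrunk by [sqrt M], the point satisfies every halfspace inequality, not only the selected ones,
   so the radius bound applies. *)
have /bnd : forall j, dot ((Num.sqrt M)^-1 *: x) (u j) <= 1.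
  move=> j; rewrite dotZl ler_pdivrMl// mulr1.
  apply: le_trans (ler_norm _) _; rewrite -ler_sqr ?nnegrE ?sqrtr_ge0//.
  by rewrite real_normK ?num_real// sqr_sqrtr ?(ltW M0) ?xj.
rewrite dotZl dotZr mulrA -invfM -expr2 sqr_sqrtr ?(ltW M0)// ltr_pdivrMl//.
by rewrite mulrC => /ltW.
Qed.

(** * The lower barrier *)

Definition supp (R : realFieldType) (J : finType) (b : J -> R) := [pred j | b j != 0].

Section Barrier.
Variables (R : realFieldType) (n : nat) (J : finType).
Variables (v : J -> 'rV[R]_n) (c : J -> R).
Hypothesis c_ge0 : forall j, 0 <= c j.
Hypothesis c_sum : \sum_j c j = n%:R.
Hypothesis c_iso : \sum_j c j *: ((v j)^T *m v j) = 1%:M.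
Hypothesis n_gt0 : (0 < n)%N.

Lemma isotropic_trace (A : 'M[R]_n) : \sum_j c j * dot (v j *m A) (v j) = \tr A.
Proof.
rewrite -[A in RHS]mulmx1 -c_iso mulmx_sumr raddf_sum; apply: eq_bigr => j _ /=.
by rewrite -scalemxAr mxtraceZ tr_outer.
Qed.

Lemma posdef1 : posdef (1%:M : 'M[R]_n).
Proof. by split=> [|x x0]; rewrite ?trmx1// mulmx1 dot_gt0. Qed.

(* [G] stands for [A - l]: the barrier [l] moves up by 1 while the potential
   [\tr (A - l)^-1] stays at most 1/2. Averaging over [c] shows that some [v j]
   may be added with weight [1 / U j] as soon as the average of [U] is small. *)
Lemma barrier_step (G : 'M[R]_n) (U : J -> R) :
  posdef G -> \tr (invmx G) <= 2^-1 ->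
  (forall j, 0 < U j) -> \sum_j c j * U j <= 2^-1 ->
  exists j, let G' := G - 1%:M + (U j)^-1 *: ((v j)^T *m v j) in
    posdef G' /\ \tr (invmx G') <= 2^-1.
Proof.
move=> pG trY U0 cU; have uG := posdef_unit pG.
set H := G - 1%:M.
(* A potential of at most 1/2 forces [G >= 2 I], so there is room to subtract the identity. *)
have pH : posdef H.
  split=> [|x x0]; first by rewrite /H linearB/= pG.1 trmx1.
  have := posdef_trace_lb x pG; have := dot_gt0 x0; have := pG.2 _ x0.
  rewrite /H mulmxBr mulmx1 dotDl dotNl => h1 h2 h3.
  have := ler_wpM2l (ltW h1) trY; lra.
have uH := posdef_unit pH.
set X := invmx H; set Y := invmx G.
have pX : posdef X := posdef_inv pH.
have pY : posdef Y := posdef_inv pG.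
have GH : G - H = 1%:M by rewrite /H opprB addrC subrK.
have XY : X = Y + X *m Y.
  rewrite -[X in X *m Y]mulmx1 -GH mulmxBr mulVmx// mulmxBl mul1mx mulmxK//.
  by rewrite addrC subrK.
have YX : X = Y + Y *m X.
  rewrite -[Y in Y *m X]mulmx1 -GH mulmxBr mulVmx// mulmxBl mul1mx mulmxK//.
  by rewrite addrC subrK.
set D := \tr (X *m Y).
have trX : \tr X = \tr Y + D by rewrite {1}XY linearD.
have D0 : 0 <= D.
  rewrite /D {1}YX mulmxDl linearD/= addr_ge0 ?posdef_sandwich_trace ?pY.1//.
  by have := posdef_sandwich_trace posdef1 pY.1; rewrite mulmx1.
(* Expanding [0 <= \tr ((X - 2 D) Y (X - 2 D))] with [\tr Y <= 1/2] gives [\tr (X Y X) >= 2 D^2]. *)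
have trXX : D + 2 * D ^+ 2 <= \tr (X *m X).
  rewrite {2}XY mulmxDr linearD/= lerD2l [leRHS]mxtrace_mulC.
  have sB : (X - (2 * D)%:M)^T = X - (2 * D)%:M by rewrite linearB/= pX.1 tr_scalar_mx.
  have := posdef_sandwich_trace pY sB.
  rewrite mulmxBl mulmxBr !mulmxBl !mul_scalar_mx !mul_mx_scalar -!scalemxAl.
  rewrite !linearB/= !mxtraceZ -/D [\tr (Y *m X)]mxtrace_mulC -/D.
  have := ler_wpM2l (sqr_ge0 D) trY; move: (\tr Y) (\tr (X *m Y *m X)) => y z.
  by move=> h1 h2; nra.
(* Averaged over [c], the left side is at most [D (1/2 + 1/2 + D) = D + D^2], which [trXX] bounds by
   the average [\tr (X X)] of the right side. *)
have [j jP] : exists j, D * (U j + dot (v j *m X) (v j)) <= dot (v j *m (X *m X)) (v j).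
  apply: contrapT => /forallNP h.
  have hj j : 0 <= c j * (D * (U j + dot (v j *m X) (v j)) - dot (v j *m (X *m X)) (v j)).
    by rewrite mulr_ge0// subr_ge0 ltW// ltNge; apply/negP/h.
  have : \sum_j c j * (D * (U j + dot (v j *m X) (v j)) - dot (v j *m (X *m X)) (v j)) <= 0.
    under eq_bigr do rewrite mulrBr mulrCA mulrDr.
    rewrite sumrB isotropic_trace -mulr_sumr big_split/= isotropic_trace trX.
    have := ler_wpM2l D0 trY; have := ler_wpM2l D0 cU; nra.
  rewrite le_eqVlt ltNge sumr_ge0// orbF => /eqP/psumr_eq0P h0.
  have c0 j : c j = 0.
    have /eqP := h0 (fun j _ => hj j) j isT; rewrite mulf_eq0 => /orP[/eqP//|].
    by rewrite subr_eq0 => /eqP e; have := h j; rewrite e lexx.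
  by have := c_sum; rewrite big1// => /esym/eqP; rewrite pnatr_eq0 -leqn0 leqNgt n_gt0.
exists j => /=; rewrite -/H; set w := (v j)^T *m v j.
have t0 : 0 < (U j)^-1 by rewrite invr_gt0.
have q0 : 0 <= dot (v j *m X) (v j) := posdef_ge0 _ pX.
split.
  apply: posdef_add => // [|x]; first by rewrite linearZ/= trmx_mul trmxK.
  rewrite -scalemxAr dotZl mulmx_outer dotZl (dotC (v j)) -expr2.
  by apply: mulr_ge0; [exact: ltW | exact: sqr_ge0].
(* The new potential is [\tr Y + D] minus [<v X^2, v> / (U + <v X, v>)], and by the choice of [j]
   this quotient is at least [D]. *)
rewrite inv_rank1//; last by rewrite gt_eqF// ltr_pwDl// mulr_ge0// ltW.
rewrite linearB/= mxtraceZ trX lerBlDr.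
have -> : \tr (invmx H *m w *m invmx H) = dot (v j *m (X *m X)) (v j).
  by rewrite mxtrace_mulC mulmxA tr_outer.
rewrite lerD// -/X.
have -> : (U j)^-1 / (1 + (U j)^-1 * dot (v j *m X) (v j)) = (U j + dot (v j *m X) (v j))^-1.
  by field; rewrite !gt_eqF ?ltr_wpDr//.
by rewrite mulrC ler_pdivlMr// ltr_wpDr.
Qed.

Hypothesis v_le1 : forall j, dot (v j) (v j) <= 1.
Hypothesis c_mean : \sum_j c j *: v j = 0.

(** The barrier starts at [-2n], where the potential is exactly [n / (2n) = 1/2], and stands at [2n]
    after [4n] steps. Each step costs at most [6n] in weight and [36 n^2] in the squared norm of the
    mean. *)
Lemma barrier_iterate k : (k <= 4 * n)%N -> exists b : J -> R,
  [/\ forall j, 0 <= b j, (#|supp b| <= k)%N,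
      \sum_j b j <= 6 * n%:R * k%:R,
      dot (\sum_j b j *: v j) (\sum_j b j *: v j) <= 36 * n%:R ^+ 2 * k%:R &
      let G := \sum_j b j *: ((v j)^T *m v j) + (2 * n%:R - k%:R)%:M in
      posdef G /\ \tr (invmx G) <= 2^-1].
Proof.
have N0 : 0 < n%:R :> R by rewrite ltr0n.
elim: k => [_|k IH kn].
  exists (fun=> 0); split=> //=.
  - by rewrite eq_card0// => j; rewrite !inE eqxx.
  - by rewrite big1// mulr0.
  - by rewrite big1 ?dot0l ?mulr0// => j _; rewrite scale0r.
  - rewrite big1 ?add0r ?subr0 => [|j _]; last by rewrite scale0r.
    have N2 : 0 < 2 * n%:R :> R by rewrite mulr_gt0.
    split.
      split=> [|x x0]; first by rewrite tr_scalar_mx.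
      by rewrite mul_mx_scalar dotZl mulr_gt0// dot_gt0.
    rewrite invmx_scalar mxtrace_scalar -[leLHS]mulr_natr invfM mulfVK ?gt_eqF//.
have [b [b0 sb Sb mb [pG trG]]] := IH (ltnW kn).
set m := \sum_j b j *: v j in mb *; set G := _ + _ in pG trG.
pose a j := dot (v j) m.
(* This [U] makes [36 n^2 - 2 a / U - 1 / U^2 >= 0], so that adding
   [v j / U j] to [m] increases [dot m m] by at most [36 n^2]. *)
pose U j := (6 * n%:R)^-1 + (18 * n%:R ^+ 2)^-1 * Num.max 0 (a j).
have U6 j : (6 * n%:R)^-1 <= U j.
  by rewrite lerDl mulr_ge0 ?le_max ?lexx// invr_ge0 mulr_ge0// exprn_ge0// ltW.
have U0 j : 0 < U j by apply: lt_le_trans (U6 j); rewrite invr_gt0 mulr_gt0.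
have cU : \sum_j c j * U j <= 2^-1.
  (* The positive part of [a] is at most [(a + 12n)^2 / (48n)]. The average of [a] vanishes and that
     of [a^2] is [dot m m <= 144 n^3]; [12n] is the resulting root mean square bound. *)
  have cm : \sum_j c j * Num.max 0 (a j) <= 6 * n%:R ^+ 2.
    have cm j : c j * Num.max 0 (a j) <=
        2^-1 * (c j * a j) + 4^-1 * ((12 * n%:R)^-1 * (c j * a j ^+ 2) + 12 * n%:R * c j).
      have -> : 2^-1 * (c j * a j) + 4^-1 * ((12 * n%:R)^-1 * (c j * a j ^+ 2) + 12 * n%:R * c j)
        = c j * ((a j + 12 * n%:R) ^+ 2 / (48 * n%:R)) by field; rewrite gt_eqF.
      apply: ler_wpM2l => //; rewrite ler_pdivlMr ?mulr_gt0//.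
      have := sqr_ge0 (a j - 12 * n%:R); have := sqr_ge0 (a j + 12 * n%:R).
      by case: (leP (a j) 0) => _ h1 h2; nra.
    apply: le_trans (ler_sum _ (fun j _ => cm j)) _.
    rewrite big_split/= -!mulr_sumr big_split/= -!mulr_sumr c_sum.
    have -> : \sum_j c j * a j = 0.
      by under eq_bigr do rewrite -dotZl; rewrite -dot_suml c_mean dot0l.
    have -> : \sum_j c j * a j ^+ 2 = dot m m.
      transitivity (dot (m *m 1%:M) m); last by rewrite mulmx1.
      rewrite -c_iso mulmx_sumr dot_suml; apply: eq_bigr => j _.
      by rewrite -scalemxAr mulmx_outer !dotZl expr2 /a (dotC m).
    have mb' : dot m m <= 144 * n%:R ^+ 3.
      apply: le_trans mb _; rewrite (_ : 144 * _ = 36 * n%:R ^+ 2 * (4 * n)%:R).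
        by rewrite ler_wpM2l ?ler_nat ?mulr_ge0 ?exprn_ge0 ?ltW// ltnW.
      by rewrite natrM; ring.
    rewrite mulr0 add0r.
    have : (12 * n%:R)^-1 * dot m m <= 12 * n%:R ^+ 2.
      rewrite ler_pdivrMl ?mulr_gt0//; apply: le_trans mb' _.
      by rewrite le_eqVlt; apply/orP; left; apply/eqP; ring.
    by move=> h; nra.
  under eq_bigr do rewrite mulrDr mulrCA.
  rewrite big_split/= -mulr_suml c_sum -mulr_sumr.
  have -> : n%:R / (6 * n%:R) = 6^-1 :> R by field; rewrite gt_eqF.
  have : (18 * n%:R ^+ 2)^-1 * \sum_j c j * Num.max 0 (a j) <= 3^-1.
    rewrite ler_pdivrMl ?mulr_gt0 ?exprn_gt0//; apply: le_trans cm _.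
    by rewrite le_eqVlt; apply/orP; left; apply/eqP; field.
  lra.
have [j [pG' trG']] := barrier_step pG trG U0 cU.
pose b' i := b i + (if i == j then (U j)^-1 else 0).
have sumE (V : lmodType R) (F : J -> V) :
    \sum_i b' i *: F i = \sum_i b i *: F i + (U j)^-1 *: F j.
  rewrite /b'; under eq_bigr do rewrite scalerDl.
  rewrite big_split/=; congr (_ + _); rewrite (bigD1 j)//= eqxx big1 ?addr0//.
  by move=> i /negPf ->; rewrite scale0r.
have t6 : (U j)^-1 <= 6 * n%:R.
  by rewrite -[leRHS]invrK lef_pV2 ?posrE ?invr_gt0 ?mulr_gt0.
exists b'; split.
- by move=> i; rewrite addr_ge0//; case: eqP => // _; rewrite invr_ge0 ltW.
- apply: leq_trans (_ : #|[predU1 j & supp b]| <= _)%N.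
    apply: subset_leq_card; apply/fintype.subsetP => i; rewrite !inE /b'.
    by case: (i =P j) => //= _; rewrite addr0.
  by rewrite cardU1; case: (_ \notin _); rewrite ?add1n ?add0n ?ltnS// ltnW.
- have := sumE R^o (fun=> 1).
  under eq_bigr do rewrite /GRing.scale/= mulr1.
  under [X in _ = X + _]eq_bigr do rewrite /GRing.scale/= mulr1.
  rewrite /GRing.scale/= mulr1 => ->; rewrite -[k.+1%:R]natr1 mulrDr mulr1.
  by rewrite lerD.
- rewrite sumE -/m !dotDl !dotDr !dotZl !dotZr (dotC m) -/(a j) -[k.+1%:R]natr1 mulrDr mulr1.
  rewrite -addrA lerD//.
  have Ua : 36 * n%:R ^+ 2 * U j = 6 * n%:R + 2 * Num.max 0 (a j).
    by rewrite /U; field; rewrite gt_eqF.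
  have aj : a j <= Num.max 0 (a j) by rewrite le_max lexx orbT.
  have U1 : 1 <= 6 * n%:R * U j by rewrite -ler_pdivrMl ?mulr_gt0// mulr1.
  (* After multiplication by [U^2] the claim is [2 a U + |v|^2 <= U (6n + 2 max(0, a))], which
     follows from [|v|^2 <= 1 <= 6n U]. *)
  rewrite addrA -(ler_pM2l (U0 j)) -(ler_pM2l (U0 j)).
  have -> : U j * (U j * ((U j)^-1 * a j + (U j)^-1 * a j
      + (U j)^-1 * ((U j)^-1 * dot (v j) (v j))))
    = 2 * a j * U j + dot (v j) (v j) by field; rewrite gt_eqF.
  rewrite [U j * (36 * _)]mulrC Ua.
  have := v_le1 j; have := ler_wpM2l (ltW (U0 j)) aj; nra.
- rewrite /= sumE (_ : _ + _ = G - 1%:M + (U j)^-1 *: ((v j)^T *m v j)); first by [].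
  rewrite /G -[k.+1%:R]natr1 opprD addrA raddfB/= !addrA -!addrA; congr (_ + _).
  by rewrite [RHS]addrA [RHS]addrC.
Qed.

(** At [k = 4n] the scalar part of the positive definite matrix is [-2n]. *)
Lemma barrier_sparsify : exists b : J -> R,
  [/\ forall j, 0 <= b j, (#|supp b| <= 4 * n)%N,
      \sum_j b j <= 24 * n%:R ^+ 2,
      dot (\sum_j b j *: v j) (\sum_j b j *: v j) <= 144 * n%:R ^+ 3 &
      forall x, 2 * n%:R * dot x x <= \sum_j b j * dot x (v j) ^+ 2].
Proof.
have [b [b0 sb Sb mb [pG _]]] := barrier_iterate (leqnn _).
rewrite natrM in Sb mb pG; exists b; split=> //.
- by apply: le_trans Sb _; rewrite le_eqVlt; apply/orP; left; apply/eqP; ring.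
- by apply: le_trans mb _; rewrite le_eqVlt; apply/orP; left; apply/eqP; ring.
move=> x; have := posdef_ge0 x pG.
rewrite mulmxDr dotDl mul_mx_scalar dotZl mulmx_sumr dot_suml.
rewrite (eq_bigr (fun j => b j * dot x (v j) ^+ 2)) => [|j _]; last first.
  by rewrite -scalemxAr dotZl mulmx_outer dotZl (dotC (v j)) expr2.
by move=> h; lra.
Qed.

End Barrier.

(** * Sparsification of John's decomposition *)

Lemma linear_relation (R : realFieldType) n (J : finType) (v : J -> 'rV[R]_n)
    (P : pred J) : (n < #|P|)%N ->
  exists a : J -> R, [/\ exists j, a j != 0, forall j, a j != 0 -> P j &
    \sum_j a j *: v j = 0].
Proof.
move=> nP; pose W := \matrix_(i < #|P|) v (enum_val i).
have : kermx W != 0.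
  by rewrite kermx_eq0 /row_free ltn_eqF// (leq_ltn_trans (rank_leq_col _)).
case/rowV0Pn => w; rewrite (sameP sub_kermxP eqP) => /eqP wW w0.
(* The kernel vector extended by zero outside [P]: at most one [i] contributes to each [j]. *)
exists (fun j => \sum_(i | enum_val i == j) w 0 i); split.
- have /rV0Pn[i wi] := w0; exists (enum_val i).
  by rewrite (big_pred1 i)// => k; rewrite /= (inj_eq enum_val_inj).
- move=> j; apply: contraR => Pj; rewrite big_pred0// => i.
  by apply: contraNF Pj => /eqP <-; exact: enum_valP.
- rewrite -[RHS]wW mulmx_sum_row [RHS](partition_big (fun i => enum_val i) predT)//=.
  apply: eq_bigr => j _; rewrite scaler_suml; apply: eq_bigr => i /eqP <-.
  by rewrite rowK.
Qed.

(** Induction on the support: subtract a multiple of a linear relation among its vectors. The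
    relation is signed to have nonnegative sum, so the total weight does not grow. *)
Lemma conic_caratheodory (R : realFieldType) n (J : finType) (v : J -> 'rV[R]_n)
    (b : J -> R) : (forall j, 0 <= b j) ->
  exists b' : J -> R, [/\ forall j, 0 <= b' j, (#|supp b'| <= n)%N,
    \sum_j b' j *: v j = \sum_j b j *: v j & \sum_j b' j <= \sum_j b j].
Proof.
have [k] := ubnP #|supp b|; elim: k b => // k IH b bk b0.
have [bn|nb] := leqP #|supp b| n; first by exists b; split.
have [a [a1 asupp av asum]] : exists a : J -> R, [/\ exists j, a j != 0,
    forall j, a j != 0 -> supp b j, \sum_j a j *: v j = 0 & 0 <= \sum_j a j].
  have [a [[j aj] asupp av]] := linear_relation v nb.
  have [sa|sa] := leP 0 (\sum_j a j); first by exists a; split=> //; exists j.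
  exists (fun j => - a j); split.
  - by exists j; rewrite oppr_eq0.
  - by move=> i; rewrite oppr_eq0; exact: asupp.
  - by under eq_bigr do rewrite scaleNr; rewrite sumrN av oppr0.
  - by rewrite sumrN oppr_ge0 ltW.
have [j0 aj0] : exists j, 0 < a j.
  apply: contrapT => /forallNP h.
  have na j : a j <= 0 by rewrite leNgt; apply/negP/h.
  have : \sum_j (- a j) = 0.
    apply/eqP; rewrite eq_le sumr_ge0 ?andbT => [|j _]; last by rewrite oppr_ge0.
    by rewrite sumrN oppr_le0.
  move/psumr_eq0P => a0; have [j /negP[]] := a1.
  by rewrite -oppr_eq0 a0// => i _; rewrite oppr_ge0.
(* The smallest ratio [b / a] is the largest multiple that keeps all weights nonnegative, and it
   kills the weight at [j]. *)
have [j aj jmin] := @arg_minP _ _ _ j0 (fun j => 0 < a j) (fun j => b j / a j) aj0.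
set t := b j / a j in jmin.
have t0 : 0 <= t by rewrite divr_ge0// ltW.
pose b1 i := b i - t * a i.
have b10 i : 0 <= b1 i.
  rewrite subr_ge0; have [ai|ai] := ltP 0 (a i).
    by rewrite -ler_pdivlMr//; exact: jmin.
  by apply: le_trans (b0 i); rewrite mulr_ge0_le0.
have [|//|b' [b'0 sb' vb' Sb']] := IH b1.
  rewrite -ltnS; apply: leq_trans bk; rewrite ltnS; apply: proper_card.
  apply/properP; split.
    apply/fintype.subsetP => i; rewrite !inE; apply: contraNneq => bi.
    rewrite /b1 bi sub0r oppr_eq0 mulf_eq0; apply/orP; right.
    by apply/negPn/negP => /asupp; rewrite /= bi eqxx.
  exists j; rewrite !inE.
    by apply: asupp; rewrite gt_eqF.
  by rewrite negbK /b1 /t divfK ?subrr// gt_eqF.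
exists b'; split=> //.
  rewrite vb'; under eq_bigr do rewrite scalerBl -scalerA.
  by rewrite sumrB -scaler_sumr av scaler0 subr0.
apply: le_trans Sb' _; rewrite sumrB -mulr_sumr gerBl.
by rewrite mulr_ge0.
Qed.

Lemma enum_family (J : finType) (P : pred J) (j0 : J) s : (#|P| <= s)%N ->
  exists f : 'I_s -> J, forall j, P j -> exists k, f k = j.
Proof.
move=> Ps; exists (fun k => nth j0 (enum P) k) => j Pj.
have jP : j \in enum P by rewrite mem_enum.
have js : (index j (enum P) < s)%N.
  by apply: leq_trans Ps; rewrite cardE index_mem.
by exists (Ordinal js); rewrite /= nth_index.
Qed.

Lemma john_subfamily (R : rcfType) n (J : finType) (v : J -> 'rV[R]_n)
    (c : J -> R) : (0 < n)%N ->
  (forall j, 0 <= c j) -> \sum_j c j = n%:R ->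
  \sum_j c j *: ((v j)^T *m v j) = 1%:M -> \sum_j c j *: v j = 0 ->
  (forall j, dot (v j) (v j) <= 1) ->
  exists f : 'I_(5 * n) -> J, forall x, (forall k, dot x (v (f k)) <= 1) ->
    dot x x <= 900 * n%:R ^+ 3.
Proof.
move=> n0 c0 cs ciso cv v1.
have N0 : 0 < n%:R :> R by rewrite ltr0n.
have N1 : 1 <= n%:R :> R by rewrite ler1n.
have [b [b0 sb Sb mb bx]] := barrier_sparsify c0 cs ciso n0 v1 cv.
set m := \sum_j b j *: v j in mb.
set q := Num.sqrt n%:R : R.
have q0 : 0 < q by rewrite sqrtr_gt0.
have qq : q ^+ 2 = n%:R by rewrite sqr_sqrtr// ltW.
have q1 : 1 <= q by rewrite -[1]sqrtr1 ler_sqrt.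
pose mu := 12 * n%:R * q.
have mu0 : 0 <= mu by rewrite !mulr_ge0// ltW.
have mu2 : dot m m <= mu ^+ 2.
  by apply: le_trans mb _; rewrite !exprMn qq le_eqVlt; apply/orP; left; apply/eqP; ring.
have vm j : `|dot (v j) m| <= mu.
  rewrite -ler_sqr ?nnegrE// real_normK ?num_real//.
  apply: le_trans (sqr_dot_le _ _) _; apply: le_trans mu2.
  by rewrite ler_piMl ?dot_ge0.
(* These weights are nonnegative since [|<v j, m>| <= mu]; by the two identities for [c] they
   represent [-m] and have total [n mu]. *)
have [j|b2 [b20 sb2 vb2 Sb2]] := @conic_caratheodory _ _ _ v (fun j => c j * (mu - dot (v j) m)).
  by rewrite mulr_ge0// subr_ge0; apply: le_trans (vm j); exact: ler_norm.
have {}vb2 : \sum_j b2 j *: v j = - m.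
  rewrite vb2; under eq_bigr do rewrite mulrBr scalerBl mulrC -scalerA.
  rewrite sumrB -scaler_sumr cv scaler0 sub0r; congr (- _).
  rewrite -[RHS]mulmx1 -ciso mulmx_sumr; apply: eq_bigr => j _.
  by rewrite -scalemxAr mulmx_outer scalerA dotC.
have {}Sb2 : \sum_j b2 j <= n%:R * mu.
  apply: le_trans Sb2 _; under eq_bigr do rewrite mulrBr -dotZl.
  by rewrite sumrB -dot_suml cv dot0l subr0 -mulr_suml cs.
have [j0 _|J0] := pickP J; last first.
  by move: cs; rewrite big_pred0// => /esym/eqP; rewrite gt_eqF.
have [|f fP] := @enum_family _ (predU (supp b) (supp b2)) j0 (5 * n).
  rewrite (_ : 5 * n = 4 * n + n)%N; last by rewrite mulSn addnC.
  apply: leq_trans (leq_add sb sb2).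
  by rewrite -cardUI leq_addr.
exists f => x xf.
have xb j : b j != 0 -> dot x (v j) <= 1.
  by move=> bj; have [|k <-] := fP j; first by rewrite /= bj.
have xb2 j : b2 j != 0 -> dot x (v j) <= 1.
  by move=> bj; have [|k <-] := fP j; first by rewrite /= bj orbT.
have xm : dot x (- m) <= n%:R * mu.
  rewrite -vb2 dot_sumr; apply: le_trans Sb2; apply: ler_sum => j _.
  rewrite dotZr; have [->|/xb2 h] := eqVneq (b2 j) 0; first by rewrite mul0r.
  by rewrite ler_piMr.
set xi := Num.sqrt (dot x x).
have xi0 : 0 <= xi by rewrite sqrtr_ge0.
have xi2 : xi ^+ 2 = dot x x by rewrite sqr_sqrtr// dot_ge0.
have h1 : \sum_j b j * dot x (v j) ^+ 2 <= xi * (48 * n%:R ^+ 2 + n%:R * mu).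
  apply: le_trans (_ : xi * (2 * \sum_j b j + dot x (- m)) <= _); last first.
    by rewrite ler_wpM2l// lerD//; lra.
  rewrite dotNr /m dot_sumr -sumrN mulr_sumr -big_split/= mulr_sumr.
  apply: ler_sum => j _; rewrite dotZr.
  have [->|/xb h] := eqVneq (b j) 0; first by rewrite !(mul0r, mulr0, oppr0, addr0).
  (* With [t = <x, v j> <= 1], the bound [t^2 <= xi (2 - t)] is the product of [|t| <= xi] and
     [|t| <= 2 - t]. *)
  have -> : xi * (2 * b j - b j * dot x (v j)) = b j * (xi * (2 - dot x (v j))) by ring.
  rewrite ler_wpM2l// -real_normK ?num_real// expr2.
  have a1 : `|dot x (v j)| <= xi.
    rewrite -ler_sqr ?nnegrE// real_normK ?num_real// xi2.
    by apply: le_trans (sqr_dot_le _ _) _; rewrite ler_piMr ?dot_ge0.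
  apply: ler_pM => //; rewrite ler_norml; apply/andP; split; lra.
have h2 : 2 * n%:R * xi ^+ 2 <= xi * (48 * n%:R ^+ 2 + n%:R * mu).
  by rewrite xi2; apply: le_trans h1; exact: bx.
have h3 : xi <= 30 * n%:R * q.
  have [->|xn0] := eqVneq xi 0; first by rewrite !mulr_ge0// ltW.
  have xgt0 : 0 < xi by rewrite lt0r xn0.
  have : 2 * xi <= 48 * n%:R + mu.
    rewrite -(ler_pM2l (mulr_gt0 xgt0 N0)).
    rewrite (_ : _ * (2 * xi) = 2 * n%:R * xi ^+ 2); last by ring.
    by apply: le_trans h2 _; rewrite le_eqVlt; apply/orP; left; apply/eqP; ring.
  have : n%:R <= n%:R * q by rewrite ler_peMr// ltW.
  rewrite /mu; lra.
rewrite -xi2; apply: le_trans (_ : (30 * n%:R * q) ^+ 2 <= _).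
  by rewrite lerXn2r ?nnegrE// !mulr_ge0// ltW.
by rewrite exprMn qq le_eqVlt; apply/orP; left; apply/eqP; ring.
Qed.

(** * Separation from finite hulls *)

Section RealContinuity.
Variables (R : realType) (T : topologicalType).
Implicit Types f g : T -> R.

Lemma continuous_add f g : continuous f -> continuous g ->
  continuous (fun x => f x + g x).
Proof. by move=> cf cg x; apply: cvgD; [exact: cf | exact: cg]. Qed.

Lemma continuous_opp f : continuous f -> continuous (fun x => - f x).
Proof. by move=> cf x; apply: cvgN; exact: cf. Qed.

Lemma continuous_mul f g : continuous f -> continuous g ->
  continuous (fun x => f x * g x).
Proof. by move=> cf cg x; apply: cvgM; [exact: cf | exact: cg]. Qed.

Lemma continuous_sum (I : Type) (r : seq I) (F : I -> T -> R) :
  (forall i, continuous (F i)) -> continuous (fun x => \sum_(i <- r) F i x).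
Proof. by move=> cF; apply: continuous_big => // i; exact: add_continuous. Qed.

Lemma continuous_prod (I : Type) (r : seq I) (F : I -> T -> R) :
  (forall i, continuous (F i)) -> continuous (fun x => \prod_(i <- r) F i x).
Proof. by move=> cF; apply: continuous_big => // i; exact: mul_continuous. Qed.

Lemma continuous_det n (F : T -> 'M[R]_n) :
  (forall i j, continuous (fun x => F x i j)) -> continuous (fun x => \det (F x)).
Proof.
move=> cF; apply: continuous_sum => s; apply: continuous_mul.
  exact: cst_continuous.
exact: continuous_prod.
Qed.

Lemma closed_le_fun f g : continuous f -> continuous g ->
  closed [set x | f x <= g x].
Proof.
move=> cf cg.
have -> : [set x | f x <= g x] = (fun x => g x + - f x) @^-1` [set y | 0 <= y].
  by apply/seteqP; split=> x /=; rewrite subr_ge0.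
apply: closed_comp (@closed_ge R 0) => x _.
by apply: continuous_add => //; exact: continuous_opp.
Qed.

End RealContinuity.

Section Extremum.
Variable R : realType.

Lemma coord_bounded_closed_compact n (D : set 'rV[R]_n) (M : R) :
  closed D -> (forall x, D x -> forall k, `|x 0 k| <= M) -> compact D.
Proof.
move=> cD bD; apply: bounded_closed_compact cD.
exists (Num.max 0 M); split; first exact: num_real.
move=> x xM y Dy /=; rewrite [leLHS]/Num.norm /= mx_normrE.
apply: bigmax_le => [|[i j] _]; first by apply: ltW (le_lt_trans _ xM); rewrite le_max lexx.
rewrite ord1 /=; apply: le_trans (bD _ Dy j) _.
by apply: ltW (le_lt_trans _ xM); rewrite le_max lexx orbT.
Qed.

Lemma continuous_max n (D : set 'rV[R]_n) (M : R) (f : 'rV[R]_n -> R) :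
  D !=set0 -> closed D -> (forall x, D x -> forall k, `|x 0 k| <= M) ->
  continuous f -> exists2 x, D x & forall y, D y -> f y <= f x.
Proof.
move=> D0 cD bD cf; have cpD := coord_bounded_closed_compact cD bD.
have [c /set_mem Dc cmax] := compact_EVT_max D0 cpD (continuous_subspaceT cf).
by exists c => // y Dy; apply: cmax; exact/mem_set.
Qed.

End Extremum.

(** The convex hull of 0 and the [p k]: the slack [1 - \sum_k c k] is the weight of 0. *)
Definition hull0 (R : realFieldType) n (K : finType) (p : K -> 'rV[R]_n) (y : 'rV[R]_n) :=
  exists c : K -> R, [/\ forall k, 0 <= c k, \sum_k c k <= 1 & y = \sum_k c k *: p k].

Section Separation.
Variable R : realType.

Lemma continuous_dotl n (w : 'rV[R]_n) : continuous (fun x => dot x w).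
Proof.
apply: continuous_sum => k; apply: continuous_mul; last exact: cst_continuous.
exact: coord_continuous.
Qed.

Lemma continuous_sqdot n (T : topologicalType) (F : T -> 'rV[R]_n) :
  (forall k, continuous (fun x => F x 0 k)) -> continuous (fun x => dot (F x) (F x)).
Proof. by move=> cF; apply: continuous_sum => k; exact: continuous_mul. Qed.

(** The distance is minimized over the compact set of coefficients, so the hull itself need not be
    shown closed. *)
Lemma hull0_nearest n (K : finType) (p : K -> 'rV[R]_n) y :
  exists2 q, hull0 p q & forall q', hull0 p q' -> dot (y - q) (y - q) <= dot (y - q') (y - q').
Proof.
pose m := #|K|; pose comb (c : 'rV[R]_m) := \sum_i c 0 i *: p (enum_val i).
pose D := [set c : 'rV[R]_m | (forall i, 0 <= c 0 i) /\ \sum_i c 0 i <= 1].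
have D0 : D !=set0.
  exists 0; split=> [i|]; first by rewrite mxE.
  by rewrite big1// => i _; rewrite mxE.
have cD : closed D.
  rewrite (_ : D = \bigcap_(i in setT) [set c | 0 <= c 0 i] `&` [set c | \sum_i c 0 i <= 1]).
    apply: closedI; last first.
      apply: closed_le_fun; last exact: cst_continuous.
      by apply: continuous_sum => i; exact: coord_continuous.
    apply: closed_bigI => i _; apply: closed_le_fun; first exact: cst_continuous.
    exact: coord_continuous.
  apply/seteqP; split=> c [c0 c1]; split=> // i; first by move=> _; exact: c0.
  exact: c0.
have bD c : D c -> forall k, `|c 0 k| <= 1.
  move=> [c0 c1] k; rewrite ger0_norm//; apply: le_trans c1.
  by rewrite (bigD1 k)//= lerDl sumr_ge0.
have cf : continuous (fun c => - dot (y - comb c) (y - comb c)).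
  apply: continuous_opp; apply: continuous_sqdot => k.
  rewrite (_ : (fun _ => _) = fun c : 'rV[R]_m => y 0 k + - \sum_i c 0 i * p (enum_val i) 0 k).
    apply: continuous_add; first exact: cst_continuous.
    apply/continuous_opp/continuous_sum => i; apply: continuous_mul; last exact: cst_continuous.
    exact: coord_continuous.
  apply/funext => c; rewrite !mxE summxE; congr (_ - _).
  by apply: eq_bigr => i _; rewrite mxE.
have [c [c0 c1] cmax] := continuous_max D0 cD bD cf.
have sumE (V : nmodType) (F : K -> V) : \sum_k F k = \sum_(i < m) F (enum_val i).
  by rewrite (reindex (@enum_val K K))//; exact/onW_bij/enum_val_bij.
exists (comb c).
  exists (fun k => c 0 (enum_rank k)); rewrite !sumE; split=> //.
    by under eq_bigr do rewrite enum_valK.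
  by apply: eq_bigr => i _; rewrite enum_valK.
move=> q [d [d0 d1 ->]].
have -> : \sum_k d k *: p k = comb (\row_i d (enum_val i)).
  by rewrite sumE; apply: eq_bigr => i _; rewrite mxE.
rewrite -lerN2; apply: cmax; split=> [i|]; first by rewrite mxE.
by under eq_bigr do rewrite mxE; rewrite -(sumE _ d).
Qed.

Lemma hull0_convex n (K : finType) (p : K -> 'rV[R]_n) (t : R) q q' :
  0 <= t <= 1 -> hull0 p q -> hull0 p q' -> hull0 p (q + t *: (q' - q)).
Proof.
move=> /andP[t0 t1] [c [c0 c1 ->]] [d [d0 d1 ->]].
exists (fun k => (1 - t) * c k + t * d k); split.
- by move=> k; rewrite addr_ge0// mulr_ge0// subr_ge0.
- rewrite big_split/= -!mulr_sumr.
  have t1' : 0 <= 1 - t by rewrite subr_ge0.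
  by have := ler_wpM2l t1' c1; have := ler_wpM2l t0 d1; lra.
- rewrite scalerBr addrA addrAC -{1}[\sum_k c k *: p k]scale1r -scalerBl.
  rewrite !scaler_sumr -big_split/=; apply: eq_bigr => k _.
  by rewrite !scalerA -scalerDl.
Qed.

(** The normal is [w = y - q] with [q] nearest to [y]. As 0 is in the hull, [<w, q> >= 0], so a
    positive separating level exists and can be scaled to 1. *)
Lemma hull0_separation n (K : finType) (p : K -> 'rV[R]_n) y :
  hull0 p y \/ exists w, (forall k, dot w (p k) <= 1) /\ 1 < dot w y.
Proof.
have [q hq qmin] := hull0_nearest p y.
have [->|yq] := eqVneq y q; [by left | right].
have [w wE] : exists w, w = y - q by exists (y - q).
rewrite -wE in qmin.
have w0 : 0 < dot w w by rewrite dot_gt0// wE subr_eq0.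
have opt q' : hull0 p q' -> dot w (q' - q) <= 0.
  move=> hq'; rewrite leNgt; apply/negP => a0.
  have [e eE] : exists e, e = q' - q by exists (q' - q).
  rewrite -eE in a0.
  have e0 : 0 < dot e e.
    by rewrite lt0r dot_ge0 andbT dot_eq0; apply: contraTneq a0 => ->; rewrite dot0r ltxx.
  (* The best step towards [q'] would be [<w, e> / <e, e>]; the extra term in the denominator keeps
     [t <= 1], and the step still decreases the distance. *)
  pose t := dot w e / (dot w e + dot e e).
  have s0 : 0 < dot w e + dot e e by rewrite addr_gt0.
  have t0 : 0 < t by rewrite divr_gt0.
  have t1 : t <= 1 by rewrite ler_pdivrMr// mul1r lerDl ltW.
  have : 0 <= t <= 1 by rewrite ltW.
  move=> /hull0_convex/(_ hq hq')/qmin; rewrite -eE opprD addrA -wE.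
  rewrite !(dotDl, dotDr, dotNl, dotNr, dotZl, dotZr) (dotC e w) => h.
  have : t * (2 * dot w e - t * dot e e) <= 0 by lra.
  rewrite pmulr_rle0// subr_le0 => h2.
  have : t * dot e e <= dot w e.
    rewrite /t mulrAC ler_pdivrMr// ler_pM2l// lerDr ltW//.
  move=> h3; have : dot w e <= 0 by lra.
  by rewrite leNgt a0.
have q0 : 0 <= dot w q.
  have : hull0 p 0.
    by exists (fun=> 0); split=> //; rewrite big1// => k _; rewrite scale0r.
  by move=> /opt; rewrite sub0r dotNr oppr_le0.
have wq k : dot w (p k) <= dot w q.
  have : hull0 p (p k).
    exists (fun i => (i == k)%:R); split.
    - by move=> i; rewrite ler0n.
    - by rewrite (bigD1 k)//= eqxx big1 ?addr0// => i /negPf ->.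
    - rewrite (bigD1 k)//= eqxx scale1r big1 ?addr0// => i /negPf ->.
      by rewrite scale0r.
  by move=> /opt; rewrite dotDr dotNr subr_le0.
have wy : dot w y = dot w q + dot w w by rewrite [X in _ + dot w X]wE dotDr dotNr addrC subrK.
(* Halfway between the maximum [<w, q>] over the hull and the value at [y]; positive even if
   [<w, q> = 0]. *)
set h := dot w q + dot w w / 2.
have h0 : 0 < h by rewrite ltr_wpDl// divr_gt0.
exists (h^-1 *: w); split=> [k|].
  rewrite dotZl ler_pdivrMl// mulr1; apply: le_trans (wq k) _.
  by rewrite lerDl divr_ge0// ltW.
by rewrite dotZl ltr_pdivlMl// mulr1 wy /h; lra.
Qed.

(** Each point of the sphere is cut off from some hull by an open halfspace; finitely many of these
    cover the sphere. *)
Lemma finite_halfspaces n (I K : finType) (p : I -> K -> 'rV[R]_n) (r2 : R) :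
  0 < r2 -> (forall x, dot x x = r2 -> ~ (forall i, hull0 (p i) x)) ->
  exists (J : finType) (u : J -> 'rV[R]_n) (i : J -> I),
    (forall j k, dot (u j) (p (i j) k) <= 1) /\
    (forall x, (forall j, dot x (u j) <= 1) -> dot x x < r2).
Proof.
move=> r0 hp; pose S := [set x : 'rV[R]_n | dot x x = r2].
have cS : closed S.
  have cd : continuous (fun x : 'rV[R]_n => dot x x).
    by apply: continuous_sqdot => k; exact: coord_continuous.
  rewrite (_ : S = [set x | dot x x <= r2] `&` [set x | r2 <= dot x x]).
    by apply: closedI; apply: closed_le_fun => //; exact: cst_continuous.
  apply/seteqP; split=> x; rewrite /S /=; first by move=> ->.
  by move=> [h1 h2]; apply/eqP; rewrite eq_le h1.
have cpS : compact S.
  apply: (@coord_bounded_closed_compact _ _ _ (1 + r2)) cS _ => x xS k.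
  have : `|x 0 k| ^+ 2 <= r2.
    rewrite real_normK ?num_real// -xS /dot (bigD1 k)//= -expr2 lerDl.
    by apply: sumr_ge0 => i _; rewrite -expr2 sqr_ge0.
  by have := sqr_ge0 (`|x 0 k| - 1); have := normr_ge0 (x 0 k); nra.
pose D := [set a : I * 'rV[R]_n | forall k, dot a.2 (p a.1 k) <= 1].
pose f (a : I * 'rV[R]_n) := [set y : 'rV[R]_n | 1 < dot y a.2].
have fo a : D a -> open (f a).
  move=> _; rewrite (_ : f a = ~` [set y | dot y a.2 <= 1]); last first.
    by apply/seteqP; split=> y; rewrite /f /= ltNge => /negP.
  apply: closed_openC; apply: closed_le_fun; last exact: cst_continuous.
  exact: continuous_dotl.
have fc : S `<=` cover D f.
  move=> y yS; have /existsNP[i hi] := hp y yS.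
  have [//|[w [wp wy]]] := hull0_separation (p i) y.
  by exists (i, w) => //; rewrite /f /= dotC.
have := cpS; rewrite compact_cover => /(_ _ D f fo fc)[D' D'D D'c].
exists D', (fun j => (val j).2), (fun j => (val j).1); split=> [j k|x hx].
  by have /set_mem := D'D _ (valP j); exact.
rewrite ltNge; apply/negP => xr.
have x0 : 0 < dot x x by exact: lt_le_trans xr.
(* A point outside the ball would shrink onto the sphere without leaving the halfspaces, as these
   contain 0. *)
pose s := Num.sqrt (r2 / dot x x).
have s1 : s <= 1 by rewrite -[1]sqrtr1 ler_sqrt// ler_pdivrMr// mul1r.
have s0 : 0 <= s by rewrite sqrtr_ge0.
have : S (s *: x).
  rewrite /S /= dotZl dotZr mulrA -expr2 sqr_sqrtr ?divfK ?gt_eqF//.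
  by rewrite divr_ge0// ltW.
move=> /D'c[a aD' /=]; rewrite /f /= dotZl ltNge => /negP; apply.
by have := hx [` aD']%fset => /= /(ler_wpM2l s0); rewrite mulr1 => /le_trans; apply.
Qed.

End Separation.

(** * John's decomposition *)

Lemma horner_char_poly (R : comNzRingType) n (A : 'M[R]_n) a :
  (char_poly A).[a] = \det (a%:M - A).
Proof.
rewrite /char_poly -horner_evalE -det_map_mx; congr (\det _).
apply/matrixP => i j; rewrite !mxE /= /horner_eval hornerD hornerN hornerC.
by rewrite hornerMn hornerX.
Qed.

(** The determinant is the characteristic polynomial of [- H] at [1/t], times [t] to the dimension.
    The top two coefficients give [1 + t \tr H]; for [t <= 1] the others contribute at most [C t^2]
    in absolute value. *)
Lemma det_perturb (R : realFieldType) n (H : 'M[R]_n) : (0 < n)%N -> 0 < \tr H ->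
  exists2 t0, 0 < t0 & forall t, 0 < t -> t <= t0 -> 1 < \det (1%:M + t *: H).
Proof.
case: n H => // n H _ trH; set p := char_poly (- H).
pose C := \sum_(i < n) `|p`_i|.
have C0 : 0 <= C by apply: sumr_ge0.
exists (Num.min 1 (\tr H / (C + 1))).
  by rewrite lt_min ltr01 divr_gt0// ltr_wpDl.
move=> t t0; rewrite le_min => /andP[t1].
rewrite ler_pdivlMr ?ltr_wpDl// => tC.
have -> : 1%:M + t *: H = t *: (t^-1%:M - - H).
  by rewrite opprK scalerDr scale_scalar_mx mulfV// gt_eqF.
rewrite detZ -horner_char_poly -/p horner_coef size_char_poly.
have pn : p`_n.+1 = 1.
  by have := char_poly_monic (- H); rewrite monicE lead_coefE size_char_poly => /eqP.
have pn1 : p`_n = \tr H by rewrite /p char_poly_trace//= linearN opprK.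
rewrite !big_ord_recr/= pn pn1 mul1r !mulrDr.
have tn0 : t != 0 by rewrite gt_eqF.
have -> : t ^+ n.+1 * t^-1 ^+ n.+1 = 1 by rewrite exprVn mulfV// expf_neq0.
have -> : t ^+ n.+1 * (\tr H * t^-1 ^+ n) = t * \tr H.
  by rewrite exprVn exprS; field; rewrite expf_neq0.
have : - (t ^+ 2 * C) <= t ^+ n.+1 * \sum_(i < n) p`_i * t^-1 ^+ i.
  rewrite /C !mulr_sumr -sumrN; apply: ler_sum => i _.
  have -> : t ^+ n.+1 * (p`_i * t^-1 ^+ i) = t ^+ 2 * (p`_i * t ^+ (n - i).-1).
    have ni : (n = (n - i).-1.+1 + i)%N by rewrite prednK ?subnK ?subn_gt0// ltnW.
    rewrite [in LHS]exprS {1}ni exprD exprS exprVn; field.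
    by rewrite expf_neq0.
  rewrite -mulrN; apply: ler_wpM2l; first exact/exprn_ge0/ltW.
  rewrite lerNl; apply: le_trans (ler_norm _) _.
  rewrite normrN normrM ler_piMr// ger0_norm; last exact/exprn_ge0/ltW.
  by apply: exprn_ile1 => //; exact: ltW.
set s := \sum_(i < n) _ => hs.
have : t ^+ 2 * C < t * \tr H by rewrite expr2 -mulrA ltr_pM2l//; lra.
lra.
Qed.

Lemma dot_row_mx (R : realFieldType) m n (a c : 'rV[R]_m) (b d : 'rV[R]_n) :
  dot (row_mx a b) (row_mx c d) = dot a c + dot b d.
Proof. by rewrite !dotE tr_row_mx mul_row_col mxE. Qed.

Lemma dot_mxvec (R : realFieldType) n (A B : 'M[R]_n) :
  dot (mxvec A) (mxvec B) = \tr (A *m B^T).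
Proof.
rewrite /dot (reindex (uncurry (@mxvec_index n n))) /=; last first.
  exact: curry_mxvec_bij.
transitivity (\sum_i \sum_j A i j * B i j).
  by rewrite pair_bigA; apply: eq_bigr => -[i j] _ /=; rewrite !mxvecE.
by apply: eq_bigr => i _; rewrite mxE; apply: eq_bigr => j _; rewrite mxE.
Qed.

Section John.
Variables (R : realType) (n : nat) (J : finType) (u : J -> 'rV[R]_n) (r2 : R).
Hypothesis n_gt0 : (0 < n)%N.
Hypothesis u_bnd : forall x, (forall j, dot x (u j) <= 1) -> dot x x < r2.

(* The ellipsoid [z + w B^T], [|w| <= 1], lies in all halfspaces [dot x (u j) <= 1]. *)
Definition inscribed (z : 'rV[R]_n) (B : 'M[R]_n) := forall j,
  0 <= 1 - dot z (u j) /\ dot (u j *m B) (u j *m B) <= (1 - dot z (u j)) ^+ 2.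

(** For [|w| <= 1] both [z + w B^T] and [z - w B^T] satisfy the halfspace inequalities; the
    parallelogram law bounds [|z|^2 + |w B^T|^2], and scaling handles other [w]. *)
Lemma inscribed_bound z B w : inscribed z B ->
  dot (w *m B^T) (w *m B^T) <= r2 * dot w w /\ dot z z < r2.
Proof.
move=> hB.
have key w' : dot w' w' <= 1 -> dot z z + dot (w' *m B^T) (w' *m B^T) < r2.
  move=> w1; set a := w' *m B^T.
  have au j : `|dot a (u j)| <= 1 - dot z (u j).
    have [f0 f1] := hB j; rewrite -ler_sqr ?nnegrE// real_normK ?num_real//.
    rewrite /a dot_mull trmxK; apply: le_trans (sqr_dot_le _ _) _.
    by apply: le_trans f1; rewrite ler_piMl ?dot_ge0.
  have h1 : dot (z + a) (z + a) < r2.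
    apply: u_bnd => j; rewrite dotDl.
    by have := le_trans (ler_norm _) (au j); lra.
  have h2 : dot (z - a) (z - a) < r2.
    apply: u_bnd => j; rewrite dotDl dotNl.
    have := au j; rewrite -normrN => h.
    by have := le_trans (ler_norm _) h; lra.
  move: h1 h2; clearbody a; rewrite !(dotDl, dotDr, dotNl, dotNr) (dotC a z).
  lra.
split; last by have := key 0; rewrite mul0mx dot0l addr0; apply; exact: ler01.
have [->|w0] := eqVneq w 0; first by rewrite mul0mx dot0l mulr0.
have ww : 0 < dot w w by rewrite dot_gt0.
pose s := Num.sqrt (dot w w).
have s0 : 0 < s by rewrite sqrtr_gt0.
have ss : s ^+ 2 = dot w w by rewrite sqr_sqrtr// ltW.
have := key (s^-1 *: w).
rewrite -scalemxAl !dotZl !dotZr mulrA -invfM -expr2 ss mulVf ?gt_eqF//.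
move=> /(_ (lexx _)); rewrite mulrA -invfM -expr2 ss => h.
have : (dot w w)^-1 * dot (w *m B^T) (w *m B^T) <= r2.
  by have := dot_ge0 z; lra.
by rewrite ler_pdivrMl// mulrC.
Qed.

(** Pairs of a matrix and a centre are packed into one row vector, to which the compactness results
    apply. *)
Let Bof (x : 'rV[R]_(n * n + n)) : 'M[R]_n := vec_mx (lsubmx x).
Let zof (x : 'rV[R]_(n * n + n)) : 'rV[R]_n := rsubmx x.

Lemma inscribed_max : exists z B, [/\ inscribed z B, 0 < \det B &
  forall z' B', inscribed z' B' -> \det B' <= \det B].
Proof.
pose D := [set x | inscribed (zof x) (Bof x)].
have cB i j : continuous (fun x => Bof x i j).
  rewrite (_ : (fun _ => _) = fun x : 'rV[R]_(n * n + n) => x 0 (lshift n (mxvec_index i j))).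
    exact: coord_continuous.
  by apply/funext => x; rewrite !mxE.
have cz j : continuous (fun x => zof x 0 j).
  rewrite (_ : (fun _ => _) = fun x : 'rV[R]_(n * n + n) => x 0 (rshift (n * n) j)).
    exact: coord_continuous.
  by apply/funext => x; rewrite !mxE.
have cf j : continuous (fun x => 1 + - dot (zof x) (u j)).
  apply: continuous_add; first exact: cst_continuous.
  apply: continuous_opp; apply: continuous_sum => k; apply: continuous_mul => //.
  exact: cst_continuous.
have cD : closed D.
  rewrite (_ : D = \bigcap_(j in setT) ([set x | 0 <= 1 + - dot (zof x) (u j)] `&`
     [set x | dot (u j *m Bof x) (u j *m Bof x) <=
              (1 + - dot (zof x) (u j)) * (1 + - dot (zof x) (u j))])).
    apply: closed_bigI => j _; apply: closedI; apply: closed_le_fun.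
    - exact: cst_continuous.
    - exact: cf.
    - apply: continuous_sqdot => k.
      rewrite (_ : (fun _ => _) = fun x => \sum_i u j 0 i * Bof x i k).
        apply: continuous_sum => i; apply: continuous_mul => //.
        exact: cst_continuous.
      by apply/funext => x; rewrite mxE.
    - exact: continuous_mul.
  apply/seteqP; split=> x h j; first by move=> _; have := h j; rewrite expr2.
  by have := h j I; rewrite /= -expr2.
have r20 : 0 <= r2.
  apply: ltW; have := u_bnd (x := 0); rewrite dot0l; apply=> j.
  by rewrite dot0l ler01.
have sq (a : R) : a ^+ 2 <= r2 -> `|a| <= 1 + r2.
  rewrite -real_normK ?num_real// => h.
  by have := sqr_ge0 (`|a| - 1); have := normr_ge0 a; nra.
have bD x : D x -> forall k, `|x 0 k| <= 1 + r2.
  move=> Dx k; apply: sq; rewrite -(hsubmxK x).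
  case: (splitP k) => [i ki|i ki].
    have -> : k = lshift n i by exact: val_inj.
    rewrite row_mxEl; have -> : lsubmx x = mxvec (Bof x) by rewrite vec_mxK.
    case/mxvec_indexP: i ki => i1 i2 _; rewrite mxvecE.
    have [+ _] := inscribed_bound (delta_mx 0 i2) Dx.
    rewrite dot_delta mxE !eqxx mulr1; apply: le_trans.
    rewrite -rowE /dot (bigD1 i1)//= !mxE -expr2 lerDl.
    by apply: sumr_ge0 => l _; rewrite -expr2 sqr_ge0.
  have -> : k = rshift (n * n) i by exact: val_inj.
  rewrite row_mxEr -/(zof x).
  have [_ /ltW] := inscribed_bound 0 Dx; apply: le_trans.
  rewrite /dot (bigD1 i)//= -expr2 lerDl.
  by apply: sumr_ge0 => l _; rewrite -expr2 sqr_ge0.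
(* A centred ball this small is inscribed, so the maximal determinant is positive. *)
pose e := (1 + \sum_j dot (u j) (u j))^-1.
have S0 : 0 <= \sum_j dot (u j) (u j) by apply: sumr_ge0 => j _; exact: dot_ge0.
have e0 : 0 < e by rewrite invr_gt0 ltr_pwDl.
have iE : inscribed 0 e%:M.
  move=> j; rewrite dot0l subr0 expr1n ler01; split=> //.
  rewrite mul_mx_scalar dotZl dotZr.
  have ej : e * dot (u j) (u j) <= 1.
    rewrite /e ler_pdivrMl ?ltr_pwDl// mulr1 (bigD1 j)//= addrCA lerDl.
    by rewrite addr_ge0// sumr_ge0// => i _; exact: dot_ge0.
  have e1 : e <= 1 by rewrite invf_le1 ?ltr_pwDl// lerDl.
  by apply: mulr_ile1 => //; [exact: ltW | rewrite mulr_ge0 ?dot_ge0 ?ltW].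
have ofE z B : zof (row_mx (mxvec B) z) = z /\ Bof (row_mx (mxvec B) z) = B.
  by rewrite /zof /Bof row_mxKr row_mxKl mxvecK.
have D0 : D !=set0.
  by exists (row_mx (mxvec e%:M) 0); rewrite /D /=; have [-> ->] := ofE 0 e%:M.
have [x Dx xmax] := continuous_max D0 cD bD (continuous_det cB).
have xm z' B' : inscribed z' B' -> \det B' <= \det (Bof x).
  have [zE BE] := ofE z' B'; move=> h; rewrite -BE; apply: xmax.
  by rewrite /D /= BE zE.
exists (zof x), (Bof x); split=> //.
by apply: lt_le_trans (xm _ _ iE); rewrite det_scalar exprn_gt0.
Qed.

(** Either [(I / n, 0)] is in the hull of 0 and the pairs [(v j^T v j, v j)], which gives the
    weights, or a separating functional [(H0, y)] yields a perturbed inscribed ellipsoid of larger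
    determinant. *)
Lemma john_decomposition : exists z B (v : J -> 'rV[R]_n) (c : J -> R),
  [/\ B \in unitmx, inscribed z B,
      forall j, 0 < 1 - dot z (u j) /\ v j = (1 - dot z (u j))^-1 *: (u j *m B),
      forall j, dot (v j) (v j) <= 1 &
      [/\ forall j, 0 <= c j, \sum_j c j = n%:R,
          \sum_j c j *: ((v j)^T *m v j) = 1%:M & \sum_j c j *: v j = 0]].
Proof.
have N0 : 0 < n%:R :> R by rewrite ltr0n.
have [z [B [iB dB Bmax]]] := inscribed_max.
have uB : B \in unitmx by rewrite unitmxE unitfE gt_eqF.
pose f j := 1 - dot z (u j).
have f0 j : 0 < f j.
  have [h1 h2] := iB j; rewrite lt0r h1 andbT; apply/eqP => fj.
  move: h2; rewrite -/(f j) fj expr0n/= => h2.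
  have /eqP : dot (u j *m B) (u j *m B) = 0.
    by apply/eqP; rewrite eq_le h2 dot_ge0.
  rewrite dot_eq0 => /eqP uB0; have := fj.
  by rewrite /f -(mulmxK uB (u j)) uB0 mul0mx dot0r subr0 => /eqP; rewrite oner_eq0.
have [v vE] : exists v, forall j, v j = (f j)^-1 *: (u j *m B).
  by exists (fun j => (f j)^-1 *: (u j *m B)).
have v1 j : dot (v j) (v j) <= 1.
  rewrite vE dotZl dotZr mulrA -invfM -expr2 ler_pdivrMl ?exprn_gt0// mulr1.
  by have [] := iB j.
exists z, B, v.
pose p j : 'rV[R]_(n * n + n) := row_mx (mxvec ((v j)^T *m v j)) (v j).
case: (hull0_separation p (row_mx (mxvec (n%:R^-1)%:M) 0)) => [[c [c0 c1 cp]]|[w [wp wy]]].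
  exists (fun j => n%:R * c j).
  have cE : \sum_j c j *: p j =
      row_mx (mxvec (\sum_j c j *: ((v j)^T *m v j))) (\sum_j c j *: v j).
    rewrite linear_sum /= /p; under eq_bigr do rewrite scale_row_mx -linearZ.
    by elim/big_rec3: _ => [|j a b d _ ->]; rewrite ?row_mx0// add_row_mx.
  move: cp; rewrite cE => /eq_row_mx[/(can_inj mxvecK) cI cv].
  have cI' : \sum_j (n%:R * c j) *: ((v j)^T *m v j) = 1%:M.
    under eq_bigr do rewrite -scalerA.
    by rewrite -scaler_sumr -cI scale_scalar_mx divff// gt_eqF.
  have c0' j : 0 <= n%:R * c j by rewrite mulr_ge0// ltW.
  split=> //; first by move=> j; split; [exact: f0 | exact: vE].
  split=> //.
    (* The hull bounds the total by [n]; taking traces with [|v j| <= 1] gives the converse. *)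
    apply/eqP; rewrite eq_le; apply/andP; split.
      by rewrite -mulr_sumr ler_piMr// ltW.
    rewrite -[leLHS](@mxtrace1 R n) -(isotropic_trace cI' 1%:M).
    by apply: ler_sum => j _; rewrite mulmx1 ler_piMr.
  by under eq_bigr do rewrite -scalerA; rewrite -scaler_sumr -cv scaler0.
exfalso.
pose H0 : 'M[R]_n := vec_mx (lsubmx w); pose y : 'rV[R]_n := rsubmx w.
have wE : w = row_mx (mxvec H0) y by rewrite vec_mxK hsubmxK.
have wp' j : dot (v j *m H0) (v j) + dot y (v j) <= 1.
  by have := wp j; rewrite wE dot_row_mx dot_mxvec trmx_mul trmxK tr_outer.
move: wy; rewrite wE dot_row_mx dot_mxvec dot0r addr0 tr_scalar_mx mul_mx_scalar mxtraceZ.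
move=> trH0.
(* Half of the excess of [\tr H0 / n] over 1: shifting by [1 + eta] leaves [\tr H = n eta > 0] and
   gains a margin of [eta |v j|^2] in the constraints. *)
pose eta := (n%:R^-1 * \tr H0 - 1) / 2.
have eta0 : 0 < eta by rewrite divr_gt0// subr_gt0.
pose H := H0 - (1 + eta)%:M.
have trH : 0 < \tr H.
  rewrite linearB/= mxtrace_scalar -[_ *+ n]mulr_natr.
  have -> : \tr H0 = n%:R * (1 + 2 * eta) by rewrite /eta; field; rewrite gt_eqF.
  have := mulr_gt0 N0 eta0; lra.
have [t0 t0_gt0 det1] := det_perturb n_gt0 trH.
pose h := \sum_j dot (v j *m H) (v j *m H).
have hj j : dot (v j *m H) (v j *m H) <= h.
  by rewrite /h (bigD1 j)//= lerDl sumr_ge0// => i _; exact: dot_ge0.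
have h0 : 0 <= h by apply: sumr_ge0 => j _; exact: dot_ge0.
pose t := Num.min t0 (Num.min (2^-1 / (1 + eta)) (2 * eta / (h + 1))).
have e1 : 0 < 1 + eta by rewrite addr_gt0.
have h1 : 0 < h + 1 by rewrite ltr_wpDl.
have t_gt0 : 0 < t.
  by rewrite !lt_min t0_gt0 /= divr_gt0 ?invr_gt0//= divr_gt0// mulr_gt0.
have t_le : t <= t0 by rewrite ge_min lexx.
have t1 : t * (1 + eta) <= 2^-1 by rewrite -ler_pdivlMr// !ge_min lexx !orbT.
have t2 : t * (h + 1) <= 2 * eta by rewrite -ler_pdivlMr// !ge_min lexx !orbT.
(* With [b = t <y, v j>] this says [|v j (1 + t H)|^2 <= 1 - 2 b], hence at most [(1 - b)^2], the
   constraint for the perturbed ellipsoid. *)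
have key j : 2^-1 * (1 + dot (v j *m (1%:M + t *: H)) (v j *m (1%:M + t *: H)))
     + t * dot y (v j) <= 1.
  have vH : dot (v j *m H) (v j) + dot y (v j) <= 1 - (1 + eta) * dot (v j) (v j).
    rewrite /H mulmxBr dotDl dotNl mul_mx_scalar dotZl.
    by have := wp' j; lra.
  rewrite mulmxDr mulmx1 -scalemxAr.
  move: (hj j) (v1 j) (dot_ge0 (v j)) vH; move: (v j) => x.
  move: (x *m H) => q; rewrite !(dotDl, dotDr, dotZl, dotZr) (dotC x q).
  move: (dot q x) (dot q q) (dot y x) (dot x x).
  move=> a b d s hq vv1 vv0 vH.
  have tge := ltW t_gt0.
  have k1 : t * (a + d) <= t * (1 - (1 + eta) * s) by exact: ler_wpM2l.
  have k2 : t * (t * b) <= t * (2 * eta).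
    by apply: ler_wpM2l => //; apply: le_trans t2; apply: ler_wpM2l => //; lra.
  have k3 : 0 <= (1 - s) * (2^-1 - t * (1 + eta)) by rewrite mulr_ge0 ?subr_ge0.
  lra.
have : \det (B *m (1%:M + t *: H)) <= \det B.
  apply: (Bmax (z + t *: (y *m B^T))) => j.
  rewrite dotDl dotZl dot_mull trmxK.
  have uE : u j *m B = f j *: v j by rewrite vE scalerA divff ?scale1r// gt_eqF.
  rewrite mulmxA uE -scalemxAl !dotZl !dotZr.
  have -> : 1 - (dot z (u j) + t * (f j * dot y (v j))) = f j * (1 - t * dot y (v j)).
    by rewrite /f; ring.
  have := key j; have := dot_ge0 (v j *m (1%:M + t *: H)).
  set a := dot (_ *m _) _; set b := t * _ => a0 k.
  split; first by rewrite mulr_ge0 ?ltW//; lra.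
  rewrite mulrA -expr2 exprMn ler_pM2l ?exprn_gt0//.
  by have := sqr_ge0 b; rewrite !expr2; lra.
by rewrite det_mulmx leNgt -[ltLHS]mulr1 ltr_pM2l// det1.
Qed.

End John.

(* Part (b) for finitely many halfspaces [dot x (u j) <= 1]. *)
Lemma halfspace_subfamily (R : realType) n (J : finType) (u : J -> 'rV[R]_n) (r2 : R) :
  (0 < n)%N ->
  (forall x, (forall j, dot x (u j) <= 1) -> dot x x < r2) ->
  exists (f : 'I_(5 * n) -> J) z, forall x, (forall k, dot x (u (f k)) <= 1) ->
    dot (x - z) (x - z) <= r2 * (900 * n%:R ^+ 3).
Proof.
move=> n0 bnd.
have [z [B [v [c [uB iB vE v1 [c0 cs cI cv]]]]]] := john_decomposition n0 bnd.
have [f fP] := john_subfamily n0 c0 cs cI cv v1.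
exists f, z => x xf.
have uBT : B^T \in unitmx by rewrite unitmx_tr.
set w := (x - z) *m invmx B^T.
have wE : w *m B^T = x - z by rewrite mulmxKV.
have [+ _] := inscribed_bound bnd w iB; rewrite wE => /le_trans; apply.
have r20 : 0 <= r2.
  by apply: ltW; have := bnd 0; rewrite dot0l; apply=> j; rewrite dot0l ler01.
apply: ler_wpM2l => //; apply: fP => k.
have [f0 ->] := vE (f k); rewrite dotZr ler_pdivrMl// mulr1.
have -> : dot w (u (f k) *m B) = dot (w *m B^T) (u (f k)) by rewrite dot_mull trmxK.
by rewrite wE dotDl dotNl lerD2r.
Qed.

(** * The theorem *)

Section Diameter.
Variables (R : realType) (n : nat).
Implicit Types (A : set 'rV[R]_n) (x y : 'rV[R]_n).

Lemma enormE x : enorm x = Num.sqrt (dot x x).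
Proof. by rewrite /enorm; congr Num.sqrt; apply: eq_bigr => k _; rewrite expr2. Qed.

Lemma enorm_le x r : 0 <= r -> (enorm x <= r) = (dot x x <= r ^+ 2).
Proof.
move=> r0; rewrite enormE -ler_sqr ?nnegrE ?sqrtr_ge0// sqr_sqrtr//.
exact: dot_ge0.
Qed.

Lemma enorm_le_diam A x y : A x -> A y -> ((enorm (x - y))%:E <= diam A)%E.
Proof. by move=> Ax Ay; apply: ereal_sup_ubound; exists (x, y). Qed.

Lemma diam_gt A r : ~ (diam A <= r%:E)%E ->
  exists x y, [/\ A x, A y & r < enorm (x - y)].
Proof.
move=> h; apply: contrapT => hx; apply: h; apply: ub_ereal_sup => _ /= [[x y] [Ax Ay] <-].
rewrite lee_fin leNgt; apply/negP => rxy; apply: hx.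
by exists x, y.
Qed.

Lemma diam1_gt0 A : diam A = 1%:E -> (0 < n)%N.
Proof.
move=> dA; rewrite lt0n; apply/eqP => n0.
suff : (diam A <= 0%:E)%E by rewrite dA lee_fin ler10.
apply: ub_ereal_sup => _ /= [[x y] _ <-].
rewrite lee_fin enorm_le// /dot big1 ?expr0n// => k _; exfalso.
by have := leq_ltn_trans (leq0n k) (ltn_ord k); rewrite n0.
Qed.

Lemma diam1_neq0 A : diam A = 1%:E -> A !=set0.
Proof.
move=> dA; apply/set0P/eqP => A0; move: dA.
by rewrite /diam A0 set0X image_set0 ereal_sup0.
Qed.

Lemma convex_setP A x y (t : R) : convex_set A -> 0 <= t <= 1 -> A x -> A y ->
  A (t *: x + (1 - t) *: y).
Proof.
move=> cA /andP[t0 t1] Ax Ay.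
by have /set_mem := cA x y (Itv01 t0 t1) (mem_set Ax) (mem_set Ay).
Qed.

(** Induction on the list of indices, with the total weight relaxed to any upper bound [t]; the
    slack is absorbed by 0. *)
Lemma hull0_subset (K : finType) (p : K -> 'rV[R]_n) A :
  (forall x y t, 0 <= t <= 1 -> A x -> A y -> A (t *: x + (1 - t) *: y)) ->
  A 0 -> (forall k, A (p k)) -> hull0 p `<=` A.
Proof.
move=> cA A0 Ap _ [c [c0 c1 ->]].
suff h (r : seq K) t : \sum_(k <- r) c k <= t ->
    exists2 a, A a & \sum_(k <- r) c k *: p k = t *: a.
  by have [a Aa ->] := h _ _ c1; rewrite scale1r.
elim: r t => [|k r IH] t; rewrite !(big_nil, big_cons).
  by move=> _; exists 0 => //; rewrite scaler0.
rewrite addrC -lerBrDr => hr; have [a Aa ->] := IH _ hr.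
have t0 : 0 <= t - c k by apply: le_trans hr; apply: sumr_ge0.
have [tE|tn0] := eqVneq t 0.
  have ck : c k = 0 by have := c0 k; move: t0; rewrite tE => ? ?; apply/eqP; rewrite eq_le; lra.
  by exists 0 => //; rewrite tE ck subrr !scale0r addr0.
have tgt : 0 < t by rewrite lt0r tn0; have := c0 k; lra.
exists (c k / t *: p k + (1 - c k / t) *: a).
  apply: cA => //; rewrite divr_ge0 ?(ltW tgt)//= ler_pdivrMr// mul1r.
  by rewrite -subr_ge0.
rewrite scalerDr !scalerA mulrBr mulr1 mulrCA divff// mulr1.
by [].
Qed.

End Diameter.

(** For [s = floor (d n)] the determinant argument has [s / (s - n + 1) < d / (d - 1)]; this brings
    in [gamma]. *)
Lemma gamma_sqr_ge (R : realType) (d : R) : 1 < d -> d / (d - 1) <= gamma d ^+ 2.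
Proof.
move=> d1; rewrite /gamma; set q := Num.sqrt d.
have q1 : 1 < q by rewrite -[1]sqrtr1 ltr_sqrt// (lt_trans ltr01).
have -> : d = q ^+ 2 by rewrite sqr_sqrtr// ltW// (lt_trans ltr01).
have e1 : 0 < q - 1 by rewrite subr_gt0.
have e2 : 0 < q + 1 by rewrite addr_gt0// (lt_trans ltr01).
rewrite subr_sqr_1 expr_div_n ler_pdivrMr ?mulr_gt0// mulrAC ler_pdivlMr ?exprn_gt0//.
have -> : (q + 1) ^+ 2 * ((q - 1) * (q + 1)) = (q - 1) * (q + 1) ^+ 3 by ring.
rewrite [(q - 1) ^+ 2]expr2 mulrCA ler_pM2l//.
have : 0 < q by lra.
by move=> q0; have := mulr_gt0 q0 q0; have := mulr_gt0 q0 (mulr_gt0 q0 q0); nra.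
Qed.

Lemma symmetric_case (R : realType) (n : nat) (I : finType) (P : I -> set 'rV[R]_n) :
  (forall i, symmetric_set (P i)) -> (forall i, convex_set (P i)) ->
  diam (\bigcap_(i in [set: I]) P i) = 1%:E ->
  forall d : R, 1 < d -> exists (s : nat) (i : 'I_s -> I),
    s%:R <= d * n%:R /\
    (diam (\bigcap_(k in [set: 'I_s]) P (i k)) <= (gamma d * Num.sqrt n%:R)%:E)%E.
Proof.
move=> sP cP dK d d1; have n0 := diam1_gt0 dK.
have N0 : 0 < n%:R :> R by rewrite ltr0n.
have dn0 : 0 <= d * n%:R by rewrite mulr_ge0 ?ltW// (lt_trans ltr01).
pose s := Num.truncn (d * n%:R); have /andP[sd ds] := truncn_itv dn0.
rewrite -/s in sd ds; exists s.
have ns : (n <= s)%N.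
  rewrite -ltnS -(ltr_nat R); apply: le_lt_trans ds.
  by rewrite ler_peMl ?ltW.
apply: contrapT => /forallNP hi.
have {}hi (g : {ffun 'I_s -> I}) : exists x, (forall k, P (g k) x) /\
    gamma d ^+ 2 * n%:R < 4 * dot x x.
  have := hi g => /not_andP[//|/diam_gt[x [y [Kx Ky xy]]]].
  (* By symmetry half the difference of two distant points is again in the sets, so one witness
     together with its negative suffices. *)
  exists (2^-1 *: x + (1 - 2^-1) *: - y); split.
    move=> k; apply: convex_setP => //; first lra; first exact: Kx.
    exact/sP/Ky.
  have h2 : (1 - 2^-1 : R) = 2^-1 by lra.
  rewrite h2 -scalerDr dotZl dotZr.
  have e0 : 0 <= gamma d * Num.sqrt n%:R.
    apply: mulr_ge0; last exact: sqrtr_ge0.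
    apply: divr_ge0; first by rewrite addr_ge0 ?sqrtr_ge0.
    by rewrite subr_ge0 -[leLHS]sqrtr1 ler_sqrt ?ltW// (lt_trans ltr01).
  have : gamma d ^+ 2 * n%:R < dot (x - y) (x - y).
    move: xy; rewrite ltNge enorm_le// -ltNge exprMn sqr_sqrtr//.
  lra.
have [x hx] := choice hi.
have K0 : (\bigcap_(i in [set: I]) P i) 0.
  have [y Ky] := diam1_neq0 dK.
  move=> i _; have := convex_setP (t := 2^-1) (cP i) _ (Ky i Logic.I) (sP i _ (Ky i Logic.I)).
  have -> : (1 - 2^-1 : R) = 2^-1 by lra.
  by rewrite scalerN subrr; apply; lra.
pose p i (a : {ffun 'I_s -> I} * bool) : 'rV[R]_n :=
  if i \in codom a.1 then (if a.2 then x a.1 else - x a.1) else 0.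
have pP i a : P i (p i a).
  rewrite /p; case: ifPn => [/codomP[k ->]|_]; last exact: K0.
  by have [xk _] := hx a.1; case: a.2; [|apply: sP].
have S0 : 0 < s%:R :> R by rewrite ltr0n; exact: leq_trans ns.
have D0 : 0 < s%:R - n%:R + 1 :> R by rewrite ltr_wpDl// subr_ge0 ler_nat.
(* Chosen so that the bound of [dopt_subfamily] becomes exactly [gamma^2 n / 4]. It exceeds 1/4, the
   largest squared norm in a symmetric set of diameter 1. *)
pose r2 := gamma d ^+ 2 / 4 * ((s%:R - n%:R + 1) / s%:R).
have r4 : 4^-1 < r2.
  have g := gamma_sqr_ge d1.
  rewrite /r2 mulrAC ltr_pdivlMr// mulVf// mulrA ltr_pdivlMr// mul1r.
  have dd : 0 < d - 1 by rewrite subr_gt0.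
  apply: lt_le_trans (ler_wpM2r (ltW D0) g).
  rewrite mulrAC ltr_pdivlMr//.
  have k1 : s%:R * (d - 1) <= (d * n%:R) * (d - 1) by apply: ler_wpM2r => //; exact: ltW.
  have k2 : d * ((d - 1) * n%:R) < d * (s%:R - n%:R + 1).
    rewrite ltr_pM2l ?(lt_trans ltr01)//.
    by move: ds; rewrite -natr1; lra.
  by apply: le_lt_trans k1 _; rewrite (_ : _ * _ = d * ((d - 1) * n%:R)); last ring.
have r0 : 0 < r2 by apply: lt_trans r4; rewrite invr_gt0.
have sph y : dot y y = r2 -> ~ (forall i, hull0 (p i) y).
  move=> yr hy.
  have Py i : P i y.
    apply: (hull0_subset _ _ (pP i) (hy i)) => [a b t|]; last exact: K0.
    exact: convex_setP.
  have Ky : (\bigcap_(i in [set: I]) P i) y by move=> i _.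
  have Kny : (\bigcap_(i in [set: I]) P i) (- y) by move=> i _; exact: sP.
  have := enorm_le_diam Ky Kny.
  rewrite dK opprK lee_fin enorm_le// expr1n dotDl !dotDr yr; lra.
have [J [u [i [up ubnd]]]] := finite_halfspaces r0 sph.
have [|f fP] := @dopt_subfamily _ _ _ u s r2 _ ubnd; first by rewrite n0.
pose g := [ffun k => i (f k)].
have [_ xg] := hx g.
have gi k : i (f k) \in codom g by apply/codomP; exists k; rewrite ffunE.
(* The witness of the selected subfamily and its negative belong to every hull used by [f], so they
   obey the selected inequalities. *)
have : dot (x g) (x g) <= r2 * (n%:R * s%:R / (s%:R - n%:R + 1)).
  apply: fP => k; rewrite dotC ler_norml; apply/andP; split.
    by have := up (f k) (g, false); rewrite /p gi /= dotNr; lra.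
  by have := up (f k) (g, true); rewrite /p gi.
have -> : r2 * (n%:R * s%:R / (s%:R - n%:R + 1)) = gamma d ^+ 2 * n%:R / 4.
  by rewrite /r2; field; rewrite !gt_eqF.
lra.
Qed.

Lemma convex_body_case (R : realType) (n : nat) (I : finType) (P : I -> set 'rV[R]_n) :
  (forall i, convex_set (P i)) ->
  diam (\bigcap_(i in [set: I]) P i) = 1%:E ->
  exists i : 'I_(5 * n) -> I,
    (diam (\bigcap_(k in [set: 'I_(5 * n)]) P (i k)) <= (120 * n%:R `^ (3 / 2))%:E)%E.
Proof.
move=> cP dK; have n0 := diam1_gt0 dK.
have N0 : 0 < n%:R :> R by rewrite ltr0n.
have powE : (n%:R : R) `^ (3 / 2) = n%:R * Num.sqrt n%:R.
  have -> : 3 / 2 = 1 + 2^-1 :> R by lra.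
  rewrite powRD; last by rewrite gt_eqF//= implybT.
  by rewrite powRr1 ?powR12_sqrt// ltW.
set s := (5 * n)%N; apply: contrapT => /forallNP hi.
have {}hi (g : {ffun 'I_s -> I}) : exists a : 'rV[R]_n * 'rV[R]_n,
    (forall k, P (g k) a.1 /\ P (g k) a.2) /\
    14400 * n%:R ^+ 3 < dot (a.1 - a.2) (a.1 - a.2).
  have /diam_gt[x [y [Kx Ky xy]]] := hi g; exists (x, y); split.
    by move=> k; split; [exact: Kx | exact: Ky].
  move: xy; rewrite ltNge enorm_le ?mulr_ge0 ?powR_ge0// -ltNge powE /=.
  rewrite !exprMn sqr_sqrtr ?ltW//.
  by rewrite (_ : 120 ^+ 2 * _ = 14400 * n%:R ^+ 3); last ring.
have [x hx] := choice hi.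
have [z0 Kz0] := diam1_neq0 dK.
(* Subtracting the common point [z0] places 0 in every translated set. *)
pose p i (a : {ffun 'I_s -> I} * bool) : 'rV[R]_n :=
  if i \in codom a.1 then (if a.2 then (x a.1).1 else (x a.1).2) - z0 else 0.
have pP i a : P i (p i a + z0).
  rewrite /p; case: ifPn => [/codomP[k ->]|_]; last by rewrite add0r; exact: Kz0.
  by rewrite subrK; have [/(_ k)[? ?] _] := hx a.1; case: a.2.
(* The radius 2 exceeds the diameter 1 of the intersection. *)
have r0 : 0 < 4 :> R by [].
have sph y : dot y y = 4 -> ~ (forall i, hull0 (p i) y).
  move=> yr hy.
  have Py i : P i (y + z0).
    have := @hull0_subset _ _ _ (p i) [set w | P i (w + z0)] _ _ (pP i) _ (hy i); apply.
      move=> a b t t01 /= Pa Pb; rewrite (_ : _ + z0 =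
        t *: (a + z0) + (1 - t) *: (b + z0)); first exact: convex_setP.
      rewrite !scalerDr addrACA -scalerDl [t + _]addrC subrK scale1r.
      by [].
    by rewrite /= add0r; exact: Kz0.
  have Ky : (\bigcap_(i in [set: I]) P i) (y + z0) by move=> i _; exact: Py.
  have := enorm_le_diam Ky Kz0.
  rewrite dK addrK lee_fin enorm_le// expr1n yr; lra.
have [J [u [i [up ubnd]]]] := finite_halfspaces r0 sph.
have [f [z fP]] := halfspace_subfamily n0 ubnd.
pose g := [ffun k => i (f k)].
have [_ xg] := hx g.
have gi k : i (f k) \in codom g by apply/codomP; exists k; rewrite ffunE.
have h1 : dot ((x g).1 - z0 - z) ((x g).1 - z0 - z) <= 4 * (900 * n%:R ^+ 3).
  by apply: fP => k; have := up (f k) (g, true); rewrite /p gi dotC.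
have h2 : dot ((x g).2 - z0 - z) ((x g).2 - z0 - z) <= 4 * (900 * n%:R ^+ 3).
  by apply: fP => k; have := up (f k) (g, false); rewrite /p gi dotC.
have eE : (x g).1 - (x g).2 = ((x g).1 - z0 - z) - ((x g).2 - z0 - z).
  by apply/rowP => k; rewrite !mxE; ring.
move: xg h1 h2; rewrite eE; move: (_ - z) ((x g).2 - z0 - z) => a b.
(* Both witnesses are within squared distance [3600 n^3] of one centre, so [|a - b|^2 <= 2 |a|^2 + 2
   |b|^2 <= 14400 n^3]. *)
have := dot_ge0 (a + b).
rewrite !(dotDl, dotDr, dotNl, dotNr) (dotC b a).
lra.
Qed.

Theorem theorem1p4 (R : realType) :
  (forall (n : nat) (I : finType) (P : I -> set 'rV[R]_n),
     (forall i, symmetric_set (P i)) ->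
     (forall i, convex_set (P i)) ->
     diam (\bigcap_(i in [set: I]) P i) = 1%:E ->
     forall d : R, 1 < d ->
     exists (s : nat) (i : 'I_s -> I),
       s%:R <= d * n%:R /\
       (diam (\bigcap_(k in [set: 'I_s]) P (i k))
          <= (gamma d * Num.sqrt n%:R)%:E)%E)
  /\
  (exists alpha c : R,
     [/\ 1 < alpha, 0 < c &
     forall (n : nat) (I : finType) (P : I -> set 'rV[R]_n),
       (forall i, convex_body (P i)) ->
       diam (\bigcap_(i in [set: I]) P i) = 1%:E ->
       exists (s : nat) (i : 'I_s -> I),
         s%:R <= alpha * n%:R /\
         (diam (\bigcap_(k in [set: 'I_s]) P (i k))
            <= (c * n%:R `^ (3 / 2))%:E)%E]).
Proof.
split; first exact: symmetric_case.
exists 5, 120; split=> [||n I P bP dK]; [by rewrite ltr1n | by rewrite ltr0n|].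
have [|i hi] := convex_body_case _ dK; first by move=> i; have [] := bP i.
by exists (5 * n)%N, i; split=> //; rewrite natrM.
Qed.
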